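(* Let $q$ be a complex number with $0<|q|<1$. Then the following three identities hold, where each sum runs over all quadruples $(i,j,k,l)$ of nonnegative integers: \begin{align*} \sum_{i,j,k,l \geq 0} \frac{q^{\frac{1}{2}(i^2 - i) + j^2 + k^2 + l^2 - il - jk - jl - 2j + 2k + l}}{(q; q)_i (q; q)_j (q; q)_k (q; q)_l} &= 8q^{-1} \frac{J_2^6}{J_1^6},\\ \sum_{i,j,k,l \geq 0} \frac{q^{i^2 + 2j^2 + 2k^2 + 2l^2 - 2il - 2jk - 2jl - 3j + 3k + l}}{(q^2; q^2)_i (q^2; q^2)_j (q^2; q^2)_k (q^2; q^2)_l} &= 2q^{-1} \frac{J_2^3}{J_1^3},\\ \sum_{i,j,k,l \geq 0} \frac{q^{\frac{1}{2}(i^2 + i) + j^2 + k^2 + l^2 - il - jk - jl - j + k}}{(q; q)_i (q; q)_j (q; q)_k (q; q)_l} &= 4 \frac{J_2^6}{J_1^6}. \end{align*}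
   Context: For a complex number $a$, a base $p$ with $|p|<1$ and an integer $n\ge 0$: $(a;p)_n:=\prod_{k=0}^{n-1}(1-ap^k)$ (so $(a;p)_0=1$) and $(a;p)_\infty:=\prod_{k=0}^{\infty}(1-ap^k)$. For a positive integer $m$, $J_m:=(q^m;q^m)_\infty$. *)

(* Defs.v *)
From mathcomp Require Import all_boot all_order all_algebra finmap.
From mathcomp Require Import all_classical all_reals all_analysis.
From mathcomp Require Import summability.

Set Implicit Arguments.
Unset Strict Implicit.
Unset Printing Implicit Defensive.

Import Order.TTheory GRing.Theory Num.Theory.
Import numFieldNormedType.Exports.
Local Open Scope classical_set_scope.
Local Open Scope ring_scope.

(* Everything is stated over a numFieldType and instantiated at the complex    *)
(* numbers R[i]: a numFieldType carries its norm topology canonically, whereas *)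
(* R[i] written out as a type does not.                                        *)

(* (a; p)_n *)
Definition qpoch (K : numFieldType) (a p : K) (n : nat) : K :=
  \prod_(k < n) (1 - a * p ^+ k).

(* (a; p)_oo *)
Definition qpoch_inf (K : numFieldType) (a p : K) : K :=
  lim (qpoch a p n @[n --> \oo]).

(* J_m = (q^m; q^m)_oo *)
Definition J (K : numFieldType) (q : K) (m : nat) : K :=
  qpoch_inf (q ^+ m) (q ^+ m).

(* Unconditional summation: the sums over finite subsets of I converge to s    *)
(* along the filter of finite subsets ordered by inclusion.                    *)
Definition has_sum (K : numFieldType) (I : choiceType) (f : I -> K) (s : K) :
    Prop :=
  partial_sum f A @[A --> totally] --> s.

(* Main.v *)
Require Import Defs.
From mathcomp Require Import all_boot all_order all_algebra finmap.
From mathcomp Require Import all_classical all_reals all_analysis.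
From mathcomp Require Import summability complex ring zify.

(** All three sums are values of one sum with a free parameter.  With base p and
    y != 0, the quadruple sum of

      p^(Q + c + 2(a - b)) y^(d - c - (a - b)) / ((p)_a (p)_b (p)_c (p)_d),
      Q = d(d-1)/2 + a^2 + b^2 + c^2 - ab - bc - cd,

    equals 2 (y/p) (-p;p)_oo^3 (-y;p)_oo^2 (-p/y;p)_oo (tadpole_sum).  The
    quadratic form is that of the tadpole diagram d - c - b - a with its loop at
    d, and the identities are the cases (p, y) = (q, 1), (q^2, q) and (q, q),
    because J_2 / J_1 = (-q;q)_oo.

    The sum over d is Euler's and produces a factor (-p/y)_c.  The edge a - b
    alone would also be easy: a^2 - ab + b^2 = (a-b)^2 + ab, and for fixed a - b
    the sum of p^(ab) / ((p)_a (p)_b) is Cauchy's.  The obstacle is the factor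
    p^(-bc) that couples b to c.  It is removed by the finite identity

      1 / ((p)_b (p)_c) = sum_s p^((b-s)(c-s)) / ((p)_s (p)_(b-s) (p)_(c-s))

    (qfac_inv_mul_sum), which turns the quadruple sum into a five-fold sum over
    a, s, u, t, d, where b = s + u and c = s + t.  There the coupling of u to t
    cancels, and with n = a - b the five sums can be done one at a time: d by
    Euler (euler_sum), u by Cauchy (cauchy_sum), t by Lebesgue's identity
    (lebesgue_sum), n in Z by the Jacobi triple product (jacobi_sum).  The sum
    that is left, over s, splits by the parity of s into two summable series
    1phi1 in base p^2 (phi11_sum); the two halves have the same value.

    Euler's and Cauchy's sums are special cases of the 1phi1 sum, and the triple
    product follows from them, so phi11_sum and lebesgue_sum are the only
    infinite identities with a proof of their own.  Both are proved by a
    contiguous relation that telescopes and is then iterated, with dominated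
    convergence (has_sum_cvg) for the limit.

    The rearrangements need the five-fold family to be absolutely summable.
    Twice its exponent is a sum of five squares of independent integers plus
    linear terms, so the family is dominated by a product of five theta series
    (abs_bounded_lifted).  Fubini's theorem (has_sum_fiber) then needs only the
    values of the inner sums, and each of these is given by an identity above.
    The field enters through one property, that absolutely bounded families
    have a sum (abs_complete); for the complex numbers it is
    complex_abs_complete. *)

Set Implicit Arguments.
Unset Strict Implicit.
Unset Printing Implicit Defensive.

Import Order.TTheory GRing.Theory Num.Theory.
Import numFieldNormedType.Exports.
Local Open Scope classical_set_scope.
Local Open Scope ring_scope.
#[local] Existing Instance totally_filter.

(** * Unconditional sums *)

Section UnconditionalSums.
Variable K : numFieldType.

Lemma partial_sumE (I : choiceType) (f : I -> K) (A : {fset I}) :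
  partial_sum f A = \sum_(i <- A) f i.
Proof. by rewrite /partial_sum big_seq_fsetE. Qed.

Lemma has_sumP (I : choiceType) (f : I -> K) (s : K) :
  has_sum f s <-> forall e : K, 0 < e -> exists A0 : {fset I},
    forall A : {fset I}, (A0 `<=` A)%fset -> `|s - \sum_(i <- A) f i| < e.
Proof.
rewrite /has_sum; split.
- move=> /cvgrPdist_lt h e e0.
  have [A0 _ hA] := h e e0.
  by exists A0 => A AA; have := hA A AA; rewrite /= partial_sumE.
- move=> h; apply/cvgrPdist_lt => e e0; have [A0 hA] := h e e0.
  by exists A0 => // A AA /=; rewrite partial_sumE; apply: hA.
Qed.

Lemma has_sum_uniq (I : choiceType) (f : I -> K) (s t : K) :
  has_sum f s -> has_sum f t -> s = t.
Proof.
move=> hs ht; apply: cvg_unique hs ht.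
exact: norm_hausdorff.
Qed.

Lemma eq_has_sum (I : choiceType) (f g : I -> K) (s : K) :
  f =1 g -> has_sum f s -> has_sum g s.
Proof. by move=> /funext ->. Qed.

Lemma has_sumZ (I : choiceType) (f : I -> K) (s c : K) :
  has_sum f s -> has_sum (fun i => c * f i) (c * s).
Proof.
move=> hs; rewrite /has_sum.
rewrite (_ : partial_sum _ = fun A => c * partial_sum f A).
  exact: cvgMr.
by apply/funext => A; rewrite /partial_sum mulr_sumr.
Qed.

Lemma has_sumD (I : choiceType) (f g : I -> K) (s t : K) :
  has_sum f s -> has_sum g t -> has_sum (fun i => f i + g i) (s + t).
Proof.
move=> hs ht; rewrite /has_sum.
rewrite (_ : partial_sum _ = fun A => partial_sum f A + partial_sum g A).
  exact: cvgD.
by apply/funext => A; rewrite /partial_sum -big_split.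
Qed.

Lemma has_sumB (I : choiceType) (f g : I -> K) (s t : K) :
  has_sum f s -> has_sum g t -> has_sum (fun i => f i - g i) (s - t).
Proof.
move=> hs /(has_sumZ (c := -1)) ht; have := has_sumD hs ht; rewrite mulN1r.
by apply: eq_has_sum => i; rewrite mulN1r.
Qed.

Lemma sum_fset_supp (I : choiceType) (f : I -> K) (A B : {fset I}) :
  (A `<=` B)%fset -> (forall i, i \notin A -> f i = 0) ->
  \sum_(i <- B) f i = \sum_(i <- A) f i.
Proof.
by move=> AB f0; apply/esym/big_fset_incl => // i _; apply: f0.
Qed.

Lemma has_sum_fin (I : choiceType) (f : I -> K) (A : {fset I}) :
  (forall i, i \notin A -> f i = 0) -> has_sum f (\sum_(i <- A) f i).
Proof.
move=> f0; apply/has_sumP => e e0; exists A => B AB.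
by rewrite (sum_fset_supp AB f0) subrr normr0.
Qed.

Lemma sum_fset_iota (f : nat -> K) n :
  \sum_(i <- [fset i in iota 0 n]%fset) f i = \sum_(i < n) f i.
Proof.
rewrite -(big_mkord xpredT f) /index_iota subn0.
by rewrite big_imfset //= undup_id ?iota_uniq.
Qed.

Lemma has_sum_ord (f : nat -> K) n :
  (forall i, (n <= i)%N -> f i = 0) -> has_sum f (\sum_(i < n) f i).
Proof.
move=> f0; rewrite -sum_fset_iota; apply: has_sum_fin => i.
by rewrite !inE /= mem_iota add0n /= -leqNgt; exact: f0.
Qed.

(** The image of the index map need not be everything: letting the family vanish
    off the image is how sums with constraints, such as s <= b, are turned into
    sums over a product of index types. *)
Lemma has_sum_reindex (I J : choiceType) (h : I -> J) (F : J -> K) s :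
  injective h -> (forall j, (forall i, h i <> j) -> F j = 0) ->
  has_sum F s <-> has_sum (F \o h) s.
Proof.
move=> hI F0.
have bigh (A : {fset I}) : \sum_(j <- [fset h i | i in A]%fset) F j = \sum_(i <- A) F (h i).
  by rewrite big_imfset //= => x y _ _ /hI.
have lift (B : {fset J}) : exists A : {fset I},
    (forall i, h i \in B -> i \in A) /\ (forall i, i \in A -> h i \in B).
  have fP : finite_set [set i | h i \in B].
    apply: (@finite_preimage _ _ [set` B]%classic h); last exact: finite_fset.
    by move=> x y _ _ /hI.
  exists (fset_set [set i | h i \in B]); by split=> i; rewrite in_fset_set ?inE.
have sumB (B : {fset J}) (A : {fset I}) : (forall i, h i \in B -> i \in A) ->
    (forall i, i \in A -> h i \in B) -> \sum_(j <- B) F j = \sum_(i <- A) F (h i).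
  move=> BA AB; rewrite -bigh.
  have AsB : ([fset h i | i in A] `<=` B)%fset.
    by apply/fsubsetP => j /imfsetP[i /= iA ->]; exact: AB.
  apply/esym/big_fset_incl => // j jB jN; apply: F0 => i hij.
  move: jN; rewrite -hij => /negP; apply.
  apply/imfsetP; exists i => //=; apply: BA; by rewrite hij.
split=> /has_sumP H; apply/has_sumP => e e0; have [A0 hA0] := H e e0.
- have [A1 [h1 h2]] := lift A0; exists A1 => A A1A.
  have := hA0 (A0 `|` [fset h i | i in A])%fset (fsubsetUl _ _).
  rewrite (sumB _ A) //.
    move=> i; rewrite inE => /orP[/h1/(fsubsetP A1A)//|/imfsetP[j /= jA /hI->//]].
  move=> i iA; rewrite inE; apply/orP; right; apply/imfsetP; by exists i.
- exists [fset h i | i in A0]%fset => B hB.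
  have [A [h1 h2]] := lift B.
  rewrite (sumB _ A) //; apply: hA0; apply/fsubsetP => i iA.
  apply: h1; apply: (fsubsetP hB); apply/imfsetP; by exists i.
Qed.

(** Fubini.  A large rectangle contains a prescribed finite set of pairs, and its
    finitely many rows are simultaneously close to their sums. *)
Lemma has_sum_fiber (I J : choiceType) (f : I * J -> K) (g : I -> K) s :
  has_sum f s -> (forall i, has_sum (fun j => f (i, j)) (g i)) -> has_sum g s.
Proof.
move=> /has_sumP hs hg; apply/has_sumP => e e0.
have [A0 hA0] := hs _ (divr_gt0 e0 (ltr0n K 2)).
exists [fset x.1 | x in A0]%fset => B hB.
pose n := (size (enum_fset B)).+1.
have e1 : 0 < e / 2 / n%:R by rewrite !divr_gt0 // ltr0n.
have /choice [D hD] : forall i, exists D : {fset J}, forall A : {fset J}, (D `<=` A)%fset ->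
   `|g i - \sum_(j <- A) f (i, j)| < e / 2 / n%:R.
  by move=> i; have /has_sumP := hg i; exact.
(* one finite set of columns that serves all rows in B and covers A0 *)
pose DD := ([fset x.2 | x in A0] `|` \bigcup_(i <- B) D i)%fset.
pose A := ([fset ((i, j) : I * J) | i in B, j in DD])%fset.
have A0A : (A0 `<=` A)%fset.
  apply/fsubsetP => -[i j] ijA; apply/imfset2P => /=.
  exists i; first by apply: (fsubsetP hB); apply/imfsetP; exists (i, j).
  exists j => //; rewrite inE; apply/orP; left; apply/imfsetP; by exists (i, j).
have := hA0 A A0A.
have -> : \sum_(x <- A) f x = \sum_(i <- B) \sum_(j <- DD) f (i, j).
  by rewrite /A big_imfset2 //= => -[? ?] [? ?] _ _ /= [-> ->].
move=> h1.
have h2 : `|\sum_(i <- B) \sum_(j <- DD) f (i, j) - \sum_(i <- B) g i| <= e / 2.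
  rewrite -sumrB.
  apply: le_trans (ler_norm_sum _ _ _) _.
  apply: (@le_trans _ _ (\sum_(i <- B) e / 2 / n%:R)).
    rewrite big_seq [leRHS]big_seq; apply: ler_sum => i iB.
    rewrite distrC; apply/ltW/hD.
    apply/fsubsetP => j jD; rewrite inE; apply/orP; right.
    by apply/bigfcupP; exists i => //; rewrite iB.
  rewrite big_const_seq count_predT iter_addr_0 -[leLHS]mulr_natr -mulrA.
  rewrite ger_pMr ?divr_gt0 // ler_pdivrMl ?ltr0n // mulr1 ler_nat.
  exact: leqnSn.
rewrite [e]splitr.
apply: le_lt_trans (ler_distD (\sum_(i <- B) \sum_(j <- DD) f (i, j)) _ _) _.
exact: ltr_leD.
Qed.

(** The index set of natural numbers is the product of the parity and the half. *)
Lemma has_sum_parity (f : nat -> K) S S0 S1 : has_sum f S ->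
  has_sum (fun m => f m.*2) S0 -> has_sum (fun m => f m.*2.+1) S1 -> S = S0 + S1.
Proof.
move=> hS h0 h1.
pose h (x : bool * nat) := (x.1 + x.2.*2)%N.
have hh : has_sum (f \o h) S.
  apply/(has_sum_reindex (h := h) (F := f)) => //.
    by move=> [[] m] [[] m'] //; rewrite /h /= => e; congr (_, _); lia.
  move=> n /(_ (odd n, n./2)); rewrite /h /= odd_double_half; by case.
have : has_sum (fun b : bool => if b then S1 else S0) S.
  by apply: has_sum_fiber hh _ => -[].
move=> /has_sum_uniq; apply.
have := @has_sum_fin _ (fun b : bool => if b then S1 else S0) [fset true; false]%fset.
rewrite big_fsetU1 ?big_seq_fset1 ?inE //= addrC; apply.
by case; rewrite !inE.
Qed.

End UnconditionalSums.

(** * Absolutely bounded families *)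

Lemma bin2S n : 'C(n.+1, 2) = ('C(n, 2) + n)%N.
Proof. by rewrite binS bin1 addnC. Qed.

Lemma bin2D m n : 'C(m + n, 2) = ('C(m, 2) + 'C(n, 2) + m * n)%N.
Proof.
elim: n => [|n IH]; first by rewrite addn0 muln0 !addn0.
by rewrite addnS !bin2S IH mulnS; lia.
Qed.

Lemma sqrn_bin2 n : (n * n)%N = (2 * 'C(n, 2) + n)%N.
Proof. by elim: n => [//|n IH]; rewrite bin2S mulSn mulnS IH; lia. Qed.

Section AbsoluteSums.
Variable K : numFieldType.

Definition abs_bounded (I : choiceType) (f : I -> K) :=
  exists M : K, forall A : {fset I}, \sum_(i <- A) `|f i| <= M.

(** The constant absorbs bounded factors such as the inverses 1 / (q)_n. *)
Lemma abs_bounded_dom (I : choiceType) (f g : I -> K) (C : K) : 0 <= C ->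
  (forall i, `|f i| <= C * `|g i|) -> abs_bounded g -> abs_bounded f.
Proof.
move=> C0 fg [M hM]; exists (C * M) => A.
apply: le_trans (ler_sum _ (fun i _ => fg i)) _.
by rewrite -mulr_sumr ler_wpM2l.
Qed.

Lemma abs_bounded_inj (I J : choiceType) (h : I -> J) (F : J -> K) :
  injective h -> abs_bounded F -> abs_bounded (F \o h).
Proof.
move=> hI [M hM]; exists M => A; have := hM [fset h i | i in A]%fset.
by rewrite big_imfset //= => x y _ _ /hI.
Qed.

Lemma sum_fset_split (I : choiceType) (f : I -> K) (A B : {fset I}) :
  (A `<=` B)%fset ->
  \sum_(i <- B) f i = \sum_(i <- A) f i + \sum_(i <- (B `\` A)%fset) f i.
Proof.
move=> AB; rewrite (big_fsetID _ (mem A) B) /=; congr (_ + _).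
  apply: eq_fbigl => i; rewrite !inE /=.
  by apply: andb_idl => /(fsubsetP AB).
by apply: eq_fbigl => i; rewrite !inE /= andbC.
Qed.

Lemma ler_sum_fset (I : choiceType) (f : I -> K) (A B : {fset I}) :
  (forall i, 0 <= f i) -> (A `<=` B)%fset ->
  \sum_(i <- A) f i <= \sum_(i <- B) f i.
Proof. by move=> f0 AB; rewrite (sum_fset_split f AB) lerDl sumr_ge0. Qed.

Lemma abs_bounded_prod (I J : choiceType) (f : I -> K) (g : J -> K) :
  abs_bounded f -> abs_bounded g ->
  abs_bounded (fun x : I * J => f x.1 * g x.2).
Proof.
move=> [M hM] [N hN]; exists (M * N) => A.
have M0 : 0 <= M by have := hM fset0; rewrite big_seq_fset0.
pose B := [fset ((i, j) : I * J) | i in [fset x.1 | x in A],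
                                   j in [fset x.2 | x in A]]%fset.
have AB : (A `<=` B)%fset.
  apply/fsubsetP => -[i j] ijA; apply/imfset2P => /=.
  exists i; first by apply/imfsetP; exists (i, j).
  by exists j => //; apply/imfsetP; exists (i, j).
apply: le_trans (ler_sum_fset (fun _ => normr_ge0 _) AB) _.
rewrite /B big_imfset2 //=; last by move=> [? ?] [? ?] _ _ /= [-> ->].
under eq_bigr => i _ do
  (under eq_bigr => j _ do rewrite normrM; rewrite -mulr_sumr).
rewrite -mulr_suml; apply: ler_pM => //; try exact: sumr_ge0.
Qed.

Lemma abs_bounded_nat (f : nat -> K) (M : K) :
  (forall n, \sum_(i < n) `|f i| <= M) -> abs_bounded f.
Proof.
move=> hM; exists M => A.
have [n lt_n] : exists n, forall i, i \in A -> (i < n)%N.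
  by exists (\max_(i <- A) i).+1 => i iA; rewrite ltnS; exact: leq_bigmax_seq.
apply: le_trans (hM n).
rewrite -(sum_fset_iota (fun i => `|f i|)).
apply: ler_sum_fset => //; apply/fsubsetP => i iA.
by rewrite !inE /= mem_iota add0n /= lt_n.
Qed.

Lemma abs_bounded_series (f : nat -> K) : abs_bounded f ->
  exists M, forall n, \sum_(i < n) `|f i| <= M.
Proof.
move=> [M hM]; exists M => n; have := hM [fset i in iota 0 n]%fset.
by rewrite sum_fset_iota.
Qed.

(** Finitely many terms do not matter for the bound, so that it suffices to
    estimate a family from some index on. *)
Lemma abs_bounded_shift (f : nat -> K) n :
  abs_bounded (fun i => f (n + i)%N) -> abs_bounded f.
Proof.
elim: n f => [//|n IH] f hf.
have /abs_bounded_series [M hM] : abs_bounded (fun i => f i.+1) by exact: IH.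
apply: (@abs_bounded_nat _ (`|f 0%N| + M)) => -[|N].
  rewrite big_ord0 addr_ge0 //; have := hM 0%N; by rewrite big_ord0.
by rewrite big_ord_recl lerD2l.
Qed.

Lemma abs_bounded_geometric (r : K) : 0 <= r -> r < 1 ->
  abs_bounded (fun n : nat => r ^+ n).
Proof.
move=> r0 r1; apply: (@abs_bounded_nat _ (1 - r)^-1) => n.
under eq_bigr => i _ do rewrite ger0_norm ?exprn_ge0 //.
have h : 0 < 1 - r by rewrite subr_gt0.
rewrite -[leRHS]mul1r ler_pdivlMr // mulrC.
have -> : (1 - r) * \sum_(i < n) r ^+ i = 1 - r ^+ n.
  by rewrite -[RHS]opprB subrX1 -mulNr opprB.
by rewrite gerBl exprn_ge0.
Qed.

(** Completeness of K, in the form in which sums need it.  It is also the source of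
    all Archimedean facts below: the geometric series has a sum, so its terms tend
    to 0. *)
Definition abs_complete := forall (I : choiceType) (f : I -> K),
  abs_bounded f -> exists s, has_sum f s.

Lemma has_sum_series (f : nat -> K) s : has_sum f s ->
  \sum_(i < n) f i @[n --> \oo] --> s.
Proof.
move=> /has_sumP hs; apply/cvgrPdist_lt => e e0.
have [A hA] := hs e e0.
exists (\max_(i <- A) i).+1 => // n /= ln.
rewrite -sum_fset_iota; apply: (hA [fset i in iota 0 n]%fset); apply/fsubsetP => i iA.
rewrite !inE /= mem_iota add0n /=; apply: leq_trans ln.
by rewrite ltnS; exact: leq_bigmax_seq.
Qed.

Lemma has_sum_term_cvg0 (f : nat -> K) s : has_sum f s -> f n @[n --> \oo] --> 0.
Proof.
move=> /has_sum_series hs.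
have h1 : \sum_(i < n.+1) f i @[n --> \oo] --> s by rewrite (cvg_shiftS (fun n => \sum_(i < n) f i)).
have -> : f = fun n => \sum_(i < n.+1) f i - \sum_(i < n) f i.
  by apply/funext => n; rewrite big_ord_recr /= addrAC subrr add0r.
by have := cvgB h1 hs; rewrite subrr; exact.
Qed.

(** Splitting off the first term: the basis of telescoping. *)
Lemma has_sum_shift (f : nat -> K) s :
  has_sum (fun n => f n.+1) s -> has_sum f (f 0%N + s).
Proof.
move=> hs.
have h0 : has_sum (fun n => if n == 0%N then f n else 0) (f 0%N).
  have := @has_sum_ord _ (fun n => if n == 0%N then f n else 0) 1.
  by rewrite big_ord1 /=; apply; case.
have h1 : has_sum (fun n => if n == 0%N then 0 else f n) s.
  apply/(@has_sum_reindex _ _ _ S) => //; first exact: succn_inj.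
  by case=> // n /(_ n).
have := has_sumD h0 h1; apply: eq_has_sum => n /=.
by case: eqP => _; rewrite ?addr0 ?add0r.
Qed.

(** If the majorant has almost all of its mass on A, so has every family below
    it; the bound does not depend on the family, which is what dominated
    convergence requires. *)
Lemma has_sum_tail (I : choiceType) (f M : I -> K) (A : {fset I}) s m e :
  (forall i, `|f i| <= M i) -> has_sum f s -> 0 < e ->
  (forall B, (A `<=` B)%fset -> `|m - \sum_(i <- B) M i| < e) ->
  `|s - \sum_(i <- A) f i| <= e + (e + e).
Proof.
move=> fM /has_sumP hs e0 hA; have [A1 hA1] := hs e e0.
pose B := (A `|` A1)%fset.
have AB : (A `<=` B)%fset by exact: fsubsetUl.
apply: le_trans (ler_distD (\sum_(i <- B) f i) _ _) _.
apply: lerD; first by apply/ltW/hA1; exact: fsubsetUr.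
have M0 i : 0 <= M i by exact: le_trans (fM i).
rewrite (sum_fset_split f AB) addrAC subrr add0r.
apply: le_trans (ler_norm_sum _ _ _) _.
apply: le_trans (ler_sum _ (fun i _ => fM i)) _.
have <- : (m - \sum_(i <- A) M i) - (m - \sum_(i <- B) M i) =
    \sum_(i <- (B `\` A)%fset) M i by rewrite (sum_fset_split M AB); ring.
set x := m - _; set y := m - _.
have hx : `|x| < e by apply: hA.
have hy : `|y| < e by apply: hA.
have xy : 0 <= x - y.
  by rewrite /x /y (sum_fset_split M AB) opprB addrC addrA addrNK addrAC subrr
    add0r sumr_ge0.
rewrite -(ger0_norm xy); apply: le_trans (ler_normB _ _) _.
by apply: lerD; exact: ltW.
Qed.

(** Dominated convergence for sums: up to a uniformly small error all the sums
    are sums over one finite set, where the limit can be taken termwise. *)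
Lemma has_sum_cvg (I : choiceType) (f : nat -> I -> K) (g M : I -> K)
    (s : nat -> K) t : abs_complete ->
  (forall n i, `|f n i| <= M i) -> (forall i, `|g i| <= M i) -> abs_bounded M ->
  (forall i, f n i @[n --> \oo] --> g i) ->
  (forall n, has_sum (f n) (s n)) -> has_sum g t -> s n @[n --> \oo] --> t.
Proof.
move=> Kc fM gM /Kc [m /has_sumP hm] fg hs ht.
apply/cvgrPdist_lt => e e0.
(* two tails of at most 3e/8 each, and e/8 for the finite part *)
have e8 : 0 < e / 8 by rewrite divr_gt0.
have [A hA] := hm _ e8.
have ht' := has_sum_tail gM ht e8 hA.
have : \sum_(i <- A) f n i @[n --> \oo] --> \sum_(i <- A) g i.
  by apply: cvg_big => //; exact: add_continuous.
move=> /cvgrPdist_lt /(_ _ e8); apply: filterS => n /= hn.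
have hs' := has_sum_tail (fM n) (hs n) e8 hA.
have -> : t - s n = (t - \sum_(i <- A) g i) + (\sum_(i <- A) g i - \sum_(i <- A) f n i)
   - (s n - \sum_(i <- A) f n i) by ring.
apply: le_lt_trans (ler_normB _ _) _.
apply: (@le_lt_trans _ _ ((e / 8 + (e / 8 + e / 8)) + e / 8 + (e / 8 + (e / 8 + e / 8)))).
  apply: lerD => //; apply: le_trans (ler_normD _ _) _; apply: lerD => //; exact: ltW.
have -> : e / 8 + (e / 8 + e / 8) + e / 8 + (e / 8 + (e / 8 + e / 8)) = e - e / 8.
  by field.
by rewrite gtrBl.
Qed.

(** Summability of f replaces the computation of partial sums: the shifted family
    has the same sum, because the first term vanishes. *)
Lemma has_sum_telescope (f : nat -> K) : abs_complete -> abs_bounded f ->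
  f 0%N = 0 -> has_sum (fun n => f n - f n.+1) 0.
Proof.
move=> Kc fb f0; have [s hs] := Kc _ _ (abs_bounded_inj succn_inj fb).
have := has_sumB (has_sum_shift hs) hs; by rewrite f0 add0r subrr.
Qed.

Lemma cvg_expr0 (r : K) : abs_complete -> 0 <= r -> r < 1 ->
  r ^+ n @[n --> \oo] --> 0.
Proof.
move=> Kc r0 r1; have [s hs] := Kc _ _ (abs_bounded_geometric r0 r1).
exact: has_sum_term_cvg0 hs.
Qed.

Lemma small_expr (r x e : K) : abs_complete -> 0 <= r -> r < 1 -> 0 <= x -> 0 < e ->
  exists N, forall n, (N <= n)%N -> x * r ^+ n <= e.
Proof.
move=> Kc r0 r1 x0 e0.
have x1 : 0 < x + 1 by rewrite ltr_wpDl.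
have /cvgrPdist_lt /(_ (e / (x + 1))) := cvg_expr0 Kc r0 r1.
move=> /(_ (divr_gt0 e0 x1)) [N _ hN]; exists N => n Nn.
have := hN n Nn; rewrite /= sub0r normrN ger0_norm ?exprn_ge0 // => h.
apply: (@le_trans _ _ ((x + 1) * r ^+ n)).
  by rewrite ler_wpM2r ?exprn_ge0 // lerDl.
by rewrite -ler_pdivlMl // mulrC ltW.
Qed.

Lemma cvg0_expr_bound (r x : K) (u : nat -> K) : abs_complete ->
  0 <= r -> r < 1 -> 0 <= x -> (forall n, `|u n| <= x * r ^+ n) ->
  u n @[n --> \oo] --> 0.
Proof.
move=> Kc r0 r1 x0 ux; apply/cvgrPdist_le => e e0.
have [N hN] := small_expr Kc r0 r1 x0 e0.
exists N => // n Nn /=; rewrite sub0r normrN; apply: le_trans (ux n) _; exact: hN.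
Qed.

(** In place of an exponential bound: the product of factors 1 + x_k is at
    most 1 / (1 - sum x_k) when the sum is less than 1, and the sum over the
    tail of a geometric progression can be made at most 1/2. *)
Lemma prod1D_bounded (r x : K) : abs_complete -> 0 <= r -> r < 1 -> 0 <= x ->
  exists B, forall n, \prod_(k < n) (1 + x * r ^+ k) <= B.
Proof.
move=> Kc r0 r1 x0.
have h1 : 0 < 1 - r by rewrite subr_gt0.
have tail y n : 0 <= y -> y <= (1 - r) / 2 -> \prod_(k < n) (1 + y * r ^+ k) <= 2.
  move=> y0 yr.
  have F k : 0 <= y * r ^+ k by rewrite mulr_ge0 ?exprn_ge0.
  have h2 : (\prod_(k < n) (1 + y * r ^+ k)) * (1 - \sum_(k < n) y * r ^+ k) <= 1.
    elim: n => [|n IH]; first by rewrite big_ord0 big_ord0 subr0 mulr1.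
    rewrite 2!big_ord_recr /=; apply: le_trans IH; rewrite -mulrA.
    apply: ler_wpM2l; first by apply: prodr_ge0 => k _; rewrite addr_ge0.
    set S := \sum_(_ < _) _; set z := y * _.
    have -> : (1 + z) * (1 - (S + z)) = 1 - S - z * (S + z) by ring.
    by rewrite gerBl mulr_ge0 ?addr_ge0 ?sumr_ge0 /z ?F.
  have h3 : \sum_(k < n) y * r ^+ k <= 1 / 2.
    rewrite -mulr_sumr.
    apply: (@le_trans _ _ (y / (1 - r))).
      rewrite ler_wpM2l // -[leRHS]mul1r ler_pdivlMr // mulrC.
      have -> : (1 - r) * \sum_(i < n) r ^+ i = 1 - r ^+ n.
        by rewrite -[RHS]opprB subrX1 -mulNr opprB.
      by rewrite gerBl exprn_ge0.
    by rewrite ler_pdivrMr // mulrC mul1r (le_trans yr) // mulrC.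
  have P0 : 0 <= \prod_(k < n) (1 + y * r ^+ k).
    by apply: prodr_ge0 => k _; rewrite addr_ge0.
  have h4 : (\prod_(k < n) (1 + y * r ^+ k)) * (1 / 2) <= 1.
    apply: le_trans h2; apply: ler_wpM2l => //.
    have -> : 1 - \sum_(k < n) y * r ^+ k = 1 / 2 + (1 / 2 - \sum_(k < n) y * r ^+ k).
      by field.
    by rewrite lerDl subr_ge0.
  by move: h4; rewrite mul1r ler_pdivrMr // mul1r.
have [N hN] := small_expr Kc r0 r1 x0 (divr_gt0 h1 (ltr0n K 2)).
exists ((\prod_(k < N) (1 + x * r ^+ k)) * 2) => n.
apply: (@le_trans _ _ (\prod_(k < N + n) (1 + x * r ^+ k))).
  rewrite addnC big_split_ord /= ler_peMr //.
    by apply: prodr_ge0 => k _; rewrite addr_ge0 ?mulr_ge0 ?exprn_ge0.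
  apply: (@le_trans _ _ (\prod_(k < N) (1 : K))); first by rewrite big1.
  by apply: ler_prod => k _; rewrite ler01 lerDl mulr_ge0 ?exprn_ge0.
rewrite big_split_ord /= ler_wpM2l //.
  by apply: prodr_ge0 => k _; rewrite addr_ge0 ?mulr_ge0 ?exprn_ge0.
under eq_bigr => k _ do rewrite exprD mulrA.
by apply: tail; [rewrite mulr_ge0 ?exprn_ge0 | exact: hN].
Qed.

(** From some index N on, the quotient of consecutive terms is at most 1/2. *)
Lemma abs_bounded_bin2 (r x : K) : abs_complete -> 0 <= r -> r < 1 -> 0 <= x ->
  abs_bounded (fun n : nat => r ^+ 'C(n, 2) * x ^+ n).
Proof.
move=> Kc r0 r1 x0.
have h2 : 0 < 2^-1 :> K by rewrite invr_gt0.
have [N hN] := small_expr Kc r0 r1 x0 h2.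
have F0 n : 0 <= r ^+ 'C(n, 2) * x ^+ n by rewrite mulr_ge0 ?exprn_ge0.
apply: (@abs_bounded_shift _ N).
apply: (@abs_bounded_dom _ _ (fun n => 2^-1 ^+ n) (r ^+ 'C(N, 2) * x ^+ N)) => //.
  move=> i; rewrite ger0_norm // normrX (gtr0_norm h2).
  have -> : r ^+ 'C(N + i, 2) * x ^+ (N + i) =
      r ^+ 'C(N, 2) * x ^+ N * (r ^+ 'C(i, 2) * (x * r ^+ N) ^+ i).
    by rewrite bin2D !exprD exprMn -exprM; ring.
  rewrite ler_wpM2l //.
  apply: (@le_trans _ _ ((x * r ^+ N) ^+ i)).
    rewrite ler_piMl ?exprn_ge0 ?mulr_ge0 ?exprn_ge0 //.
    by rewrite exprn_ile1 // ltW.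
  rewrite lerXn2r ?nnegrE ?mulr_ge0 ?exprn_ge0 // ?hN //; exact: ltW.
by apply: abs_bounded_geometric; [exact: ltW | rewrite invf_lt1 // ltr1n].
Qed.

Lemma abs_bounded_theta_nat (r x : K) : abs_complete -> 0 <= r -> r < 1 -> 0 <= x ->
  abs_bounded (fun n : nat => r ^+ (n * n) * x ^+ n).
Proof.
move=> Kc r0 r1 x0.
have -> : (fun n : nat => r ^+ (n * n) * x ^+ n) =
          (fun n => (r ^+ 2) ^+ 'C(n, 2) * (r * x) ^+ n).
  by apply/funext => n; rewrite sqrn_bin2 exprD exprM [(r * x) ^+ n]exprMn; ring.
by apply: abs_bounded_bin2; rewrite ?mulr_ge0 ?exprn_ge0 // exprn_ilt1.
Qed.

Lemma abs_bounded_bool (f : bool -> K) : abs_bounded f.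
Proof.
exists (`|f true| + `|f false|) => A.
have -> : `|f true| + `|f false| = \sum_(b <- [fset true; false]%fset) `|f b|.
  by rewrite big_fsetU1 ?big_seq_fset1 // !inE.
by apply: ler_sum_fset => //; apply/fsubsetP => -[] _; rewrite !inE.
Qed.

(** A two-sided theta series is bounded by the one-sided series in x + 1/x,
    once for each sign of the index. *)
Lemma abs_bounded_theta (r x : K) : abs_complete -> 0 <= r -> r < 1 -> 0 < x ->
  abs_bounded (fun k : int => r ^+ (`|k| * `|k|) * x ^ k).
Proof.
move=> Kc r0 r1 x0.
pose h (k : int) := (k < 0, `|k|%N).
have hI : injective h by rewrite /h => -[m|m] [n|n] //= [] //; rewrite ?absz_nat // => ->.
pose F (y : bool * nat) := (fun=> 1) y.1 * (fun n : nat => r ^+ (n * n) * (x + x^-1) ^+ n) y.2.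
have xV : 0 < x^-1 by rewrite invr_gt0.
apply: (@abs_bounded_dom _ _ (F \o h) 1) => //.
  move=> k; rewrite /F /= !mul1r !normrM !normrX.
  rewrite ler_wpM2l ?exprn_ge0 //.
  rewrite (ger0_norm (ltW (addr_gt0 x0 xV))) ger0_norm ?exprz_ge0 ?(ltW x0) //.
  case: k => n /=.
    by rewrite -exprnP lerXn2r ?nnegrE ?addr_ge0 ?ltW // ltrDl.
  by rewrite NegzE -exprnN -exprVn lerXn2r ?nnegrE ?addr_ge0 ?ltW // ltrDr //.
apply: abs_bounded_inj hI _.
apply: abs_bounded_prod; first exact: abs_bounded_bool.
by apply: abs_bounded_theta_nat => //; rewrite addr_ge0 // ltW.
Qed.

End AbsoluteSums.

(** * Finite and infinite q-Pochhammer symbols *)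

Section Pochhammer.
Variable K : numFieldType.
Implicit Types (a c q : K).

Lemma cvg_seq_uniq (u : nat -> K) (s t : K) :
  u n @[n --> \oo] --> s -> u n @[n --> \oo] --> t -> s = t.
Proof. by apply: cvg_unique; exact: norm_hausdorff. Qed.

Lemma qpoch0 a q : qpoch a q 0 = 1.
Proof. by rewrite /qpoch big_ord0. Qed.

Lemma qpochSr a q n : qpoch a q n.+1 = qpoch a q n * (1 - a * q ^+ n).
Proof. by rewrite /qpoch big_ord_recr. Qed.

Lemma qpochSl a q n : qpoch a q n.+1 = (1 - a) * qpoch (a * q) q n.
Proof.
rewrite /qpoch big_ord_recl /= expr0 mulr1; congr (_ * _).
by apply: eq_bigr => i _; rewrite exprS mulrA.
Qed.

Lemma qpochD a q m n : qpoch a q (m + n) = qpoch a q m * qpoch (a * q ^+ m) q n.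
Proof.
rewrite /qpoch big_split_ord /=; congr (_ * _).
by apply: eq_bigr => i _; rewrite exprD mulrA.
Qed.

Lemma qpoch_double a q n :
  qpoch a q n.*2 = qpoch a (q ^+ 2) n * qpoch (a * q) (q ^+ 2) n.
Proof.
elim: n => [|n IH]; first by rewrite !qpoch0 mulr1.
by rewrite doubleS !qpochSr IH -!exprM mul2n (exprS q n.*2); ring.
Qed.

Lemma qpoch_mulN a q n :
  qpoch a q n * qpoch (- a) q n = qpoch (a ^+ 2) (q ^+ 2) n.
Proof.
rewrite /qpoch -big_split /=; apply: eq_bigr => i _.
by rewrite -exprM mulnC exprM; ring.
Qed.

Lemma prod_linear (Q z c : K) m : z != 0 ->
  \prod_(k < m) (z - c * Q ^+ k) = z ^+ m * qpoch (c / z) Q m.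
Proof.
move=> z0; have -> : z ^+ m = \prod_(k < m) z by rewrite prodr_const card_ord.
rewrite /qpoch -big_split /=; apply: eq_bigr => k _.
by rewrite mulrBr mulr1 mulrA mulrCA divff // mulr1.
Qed.

Hypothesis Kc : abs_complete K.

Lemma qpoch_bounded q (x : K) : `|q| < 1 -> 0 <= x ->
  exists B, forall a n, `|a| <= x -> `|qpoch a q n| <= B.
Proof.
move=> q1 x0; have [B hB] := prod1D_bounded Kc (normr_ge0 q) q1 x0.
exists B => a n ax; apply: le_trans (hB n).
rewrite /qpoch normr_prod; apply: ler_prod => k _; rewrite normr_ge0 /=.
apply: le_trans (ler_normB _ _) _; rewrite normr1 lerD2l normrM normrX.
by rewrite ler_wpM2r ?exprn_ge0.
Qed.

Lemma sub_norm_gt0 c q n : `|q| <= 1 -> `|c| < 1 -> 0 < 1 - `|c| * `|q| ^+ n.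
Proof.
move=> q1 c1; rewrite subr_gt0; apply: le_lt_trans c1.
by rewrite ler_piMr // exprn_ile1.
Qed.

Lemma qpoch_neq0 c q n : `|q| <= 1 -> `|c| < 1 -> qpoch c q n != 0.
Proof.
move=> q1 c1; apply/prodf_neq0 => k _; rewrite subr_eq0.
apply/eqP => h; have := sub_norm_gt0 k q1 c1.
by rewrite -normrX -normrM -h normr1 subrr ltxx.
Qed.

(** Uniform in c, because 1 / (1 - x r^k) <= 1 + (x / (1 - x)) r^k. *)
Lemma qpochV_bounded q (x : K) : `|q| < 1 -> 0 <= x -> x < 1 ->
  exists B, forall c n, `|c| <= x -> `|(qpoch c q n)^-1| <= B.
Proof.
move=> q1 x0 x1.
have h1 : 0 < 1 - x by rewrite subr_gt0.
have y0 : 0 <= x / (1 - x) by rewrite divr_ge0 // ltW.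
have [B hB] := prod1D_bounded Kc (normr_ge0 q) q1 y0.
exists B => c n cx; apply: le_trans (hB n).
rewrite /qpoch -prodfV normr_prod; apply: ler_prod => k _; rewrite normr_ge0 /=.
set r := `|q| ^+ k.
have r0 : 0 <= r by exact: exprn_ge0.
have r1 : r <= 1 by rewrite exprn_ile1 // ltW.
have h2 : 1 - x * r <= `|1 - c * q ^+ k|.
  apply: le_trans (lerB_dist _ _); rewrite normr1 lerB // normrM normrX.
  by rewrite ler_wpM2r.
have h3 : 0 < 1 - x * r.
  by rewrite subr_gt0; apply: le_lt_trans x1; rewrite ler_piMr.
have h4 : 0 < `|1 - c * q ^+ k| by exact: lt_le_trans h2.
rewrite normfV; apply: (@le_trans _ _ (1 - x * r)^-1).
  by rewrite lef_pV2.
rewrite -[leLHS]mul1r ler_pdivrMr //.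
have -> : (1 + x / (1 - x) * r) * (1 - x * r) = 1 + x ^+ 2 * r * (1 - r) / (1 - x).
  by field; rewrite gt_eqF.
rewrite lerDl; apply: divr_ge0; last exact: ltW.
by rewrite !mulr_ge0 ?exprn_ge0 // subr_ge0.
Qed.

(** The differences of consecutive partial products are dominated by a geometric
    progression. *)
Lemma qpoch_cvg a q : `|q| < 1 -> qpoch a q n @[n --> \oo] --> qpoch_inf a q.
Proof.
move=> q1; apply/cvg_ex.
have [B hB] := qpoch_bounded q1 (normr_ge0 a).
have [s hs] : exists s, has_sum (fun n => - (a * q ^+ n * qpoch a q n)) s.
  apply: Kc; apply: (@abs_bounded_dom _ _ _ (fun n => `|q| ^+ n) (`|a| * B)).
  - by apply: mulr_ge0 => //; apply: le_trans (hB a 0%N _).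
  - move=> n; rewrite normrN !normrM !normrX normr_id -mulrA [_ * `|qpoch _ _ _|]mulrC mulrA.
    by rewrite ler_wpM2r ?exprn_ge0 // ler_wpM2l // hB.
  exact: abs_bounded_geometric.
exists (1 + s).
have -> : qpoch a q = fun n => 1 + \sum_(i < n) - (a * q ^+ i * qpoch a q i).
  apply/funext; elim=> [|n IH]; first by rewrite qpoch0 big_ord0 addr0.
  by rewrite qpochSr big_ord_recr /= addrA -IH; ring.
by apply: cvgD; [exact: cvg_cst | exact: (has_sum_series hs)].
Qed.

Arguments qpoch_cvg a {q} _.

Lemma qpoch_inf_lim a q (s : K) : `|q| < 1 ->
  qpoch a q n @[n --> \oo] --> s -> qpoch_inf a q = s.
Proof.
by move=> q1 h; exact: (@cvg_seq_uniq (qpoch a q) _ _ (qpoch_cvg a q1) h).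
Qed.

Lemma qpoch_infD a q n : `|q| < 1 ->
  qpoch_inf a q = qpoch a q n * qpoch_inf (a * q ^+ n) q.
Proof.
move=> q1; apply: qpoch_inf_lim => //.
rewrite -(cvg_shiftn n).
under eq_fun => m do rewrite addnC qpochD.
by apply: cvgMr; exact: (qpoch_cvg _ q1).
Qed.

Lemma qpoch_inf_double a q : `|q| < 1 ->
  qpoch_inf a q = qpoch_inf a (q ^+ 2) * qpoch_inf (a * q) (q ^+ 2).
Proof.
move=> q1.
have q2 : `|q ^+ 2| < 1 by rewrite normrX exprn_ilt1.
apply: (fun h => cvg_seq_uniq h (cvgM (qpoch_cvg a q2) (qpoch_cvg (a * q) q2))).
under eq_fun => n do rewrite -qpoch_double.
have := @cvg_comp _ _ _ double (qpoch a q) \oo \oo _ _ (qpoch_cvg a q1).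
apply.
move=> A [N _ hN]; exists N => // n /= Nn; apply: hN.
by rewrite /= -addnn (leq_trans Nn) // leq_addr.
Qed.

Lemma qpoch_inf_mulN a q : `|q| < 1 ->
  qpoch_inf a q * qpoch_inf (- a) q = qpoch_inf (a ^+ 2) (q ^+ 2).
Proof.
move=> q1; apply/esym.
have q2 : `|q ^+ 2| < 1 by rewrite normrX exprn_ilt1.
apply: qpoch_inf_lim => //.
under eq_fun => n do rewrite -qpoch_mulN.
by apply: cvgM; exact: (qpoch_cvg _ q1).
Qed.

(** The inverses of the partial products are bounded, so the limit is not 0. *)
Lemma qpoch_inf_neq0 c q : `|q| < 1 -> `|c| < 1 -> qpoch_inf c q != 0.
Proof.
move=> q1 c1; have [B hB] := qpochV_bounded q1 (normr_ge0 c) c1.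
apply/eqP => h.
have h0 : qpoch c q n @[n --> \oo] --> 0 by rewrite -h; exact: (qpoch_cvg _ q1).
have B1 : 1 <= B.
  by have := hB c 0%N (lexx _); rewrite qpoch0 invr1 normr1.
have B0 : 0 < B by exact: lt_le_trans B1.
have /cvgrPdist_lt /(_ B^-1) := h0; rewrite invr_gt0 => /(_ B0) [N _ hN].
have := hN N (leqnn _); rewrite /= sub0r normrN => h1.
have := hB c N (lexx _); rewrite normfV => h2.
have h3 : 0 < `|qpoch c q N| by rewrite normr_gt0 qpoch_neq0 // ltW.
have := lt_le_trans h1 (_ : B^-1 <= `|qpoch c q N|).
rewrite ltxx => H; suff: false by []; apply: H.
by rewrite -[leRHS]invrK lef_pV2 // posrE invr_gt0.
Qed.

End Pochhammer.
Arguments qpoch_cvg {K} Kc a {q} _.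

(** * The sum of the 1phi1 series *)

Section QSeries.
Variable K : numFieldType.
Hypothesis Kc : abs_complete K.
Variable q : K.
Hypothesis q1 : `|q| < 1.
Implicit Types (a c x z : K).

Let q1w : `|q| <= 1. Proof. exact: ltW. Qed.

Lemma qpochqq_neq0 n : qpoch q q n != 0.
Proof. exact: qpoch_neq0. Qed.

(** The general term of 1phi1(c/z; c; q, z), with z^n (c/z)_n written as a
    product of factors z - c q^k: in this form z = 0 and c = 0 are allowed, and
    they give Cauchy's and Euler's sums. *)
Definition phi11 z c n : K :=
  (-1) ^+ n * q ^+ 'C(n, 2) * \prod_(k < n) (z - c * q ^+ k) /
  (qpoch q q n * qpoch c q n).

Lemma phi11_0 z c : phi11 z c 0 = 1.
Proof. by rewrite /phi11 big_ord0 !qpoch0 bin0n /= !expr0 !mulr1 divr1. Qed.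

Lemma phi11_bounded (x : K) : 0 <= x -> x < 1 -> exists2 C, 0 <= C &
  forall z c n, `|c| <= x -> `|phi11 z c n| <= C * (`|q| ^+ 'C(n, 2) * (`|z| + `|c|) ^+ n).
Proof.
move=> x0 x1.
have [B1 hB1] := qpochV_bounded Kc q1 (normr_ge0 q) q1.
have [B2 hB2] := qpochV_bounded Kc q1 x0 x1.
have B10 : 0 <= B1 by apply: le_trans (hB1 q 0%N _).
have B20 : 0 <= B2 by apply: le_trans (hB2 0 0%N _) => //; rewrite normr0.
exists (B1 * B2); first exact: mulr_ge0.
move=> z c n cx; rewrite /phi11 invfM !normrM !normrX normrN1 expr1n mul1r.
rewrite mulrC; apply: ler_pM => //.
  by apply: ler_pM => //; [exact: hB1 | exact: hB2].
rewrite ler_wpM2l ?exprn_ge0 // normr_prod.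
have -> : (`|z| + `|c|) ^+ n = \prod_(k < n) (`|z| + `|c|) by rewrite prodr_const card_ord.
apply: ler_prod => k _; rewrite normr_ge0 /=.
apply: le_trans (ler_normB _ _) _; rewrite lerD2l normrM normrX.
by rewrite ler_piMr // exprn_ile1.
Qed.

Lemma abs_bounded_phi11 z c : `|c| < 1 -> abs_bounded (phi11 z c).
Proof.
move=> c1; have [C C0 hC] := phi11_bounded (normr_ge0 c) c1.
apply: abs_bounded_dom C0 _ (abs_bounded_bin2 Kc (normr_ge0 q) q1 (addr_ge0 (normr_ge0 z) (normr_ge0 c))).
move=> n; apply: le_trans (hC _ _ _ (lexx _)) _.
by rewrite [X in _ <= _ * X]ger0_norm // mulr_ge0 ?exprn_ge0 ?addr_ge0.
Qed.

(** A contiguous relation.  The difference of the two series telescopes, with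
    V n a multiple of the general term that vanishes at 0. *)
Lemma phi11_shift z c s t : `|c| < 1 ->
  has_sum (phi11 z c) s -> has_sum (phi11 (z * q) (c * q)) t ->
  (1 - c) * s = (1 - z) * t.
Proof.
move=> c1 hs ht.
pose V n := (1 - c) * ((1 - q ^+ n) * phi11 z c n).
have hV : has_sum (fun n => V n - V n.+1) 0.
  apply: has_sum_telescope => //; last by rewrite /V expr0 subrr mul0r mulr0.
  have [C C0 hC] := phi11_bounded (normr_ge0 c) c1.
  have C4 : 0 <= `|1 - c| * 2 * C by rewrite !mulr_ge0.
  apply: abs_bounded_dom C4 _ (abs_bounded_bin2 Kc (normr_ge0 q) q1 (addr_ge0 (normr_ge0 z) (normr_ge0 c))).
  move=> n; rewrite [X in _ <= _ * X]ger0_norm; last first.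
    by rewrite mulr_ge0 ?exprn_ge0 ?addr_ge0.
  rewrite /V normrM (normrM (1 - q ^+ n)) -!mulrA ler_wpM2l //; apply: ler_pM => //; last exact: (hC _ _ _ (lexx _)).
  apply: le_trans (ler_normB _ _) _; rewrite normr1 normrX.
  by rewrite -[2]/(1 + 1) lerD2l exprn_ile1.
apply/eqP; rewrite -subr_eq0; apply/eqP; apply: has_sum_uniq hV.
have := has_sumB (has_sumZ (c := 1 - c) hs) (has_sumZ (c := 1 - z) ht).
apply: eq_has_sum => n; rewrite /V /phi11.
have cq1 : `|c * q| < 1 by rewrite normrM mulr_ilt1.
have -> : \prod_(k < n) (z * q - c * q * q ^+ k) = q ^+ n * \prod_(k < n) (z - c * q ^+ k).
  have -> : q ^+ n = \prod_(k < n) q by rewrite prodr_const card_ord.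
  by rewrite -big_split /=; apply: eq_bigr => k _; ring.
rewrite big_ord_recr /= bin2S exprD exprS.
set P := \prod_(k < n) _.
have e1 : qpoch c q n * (1 - c * q ^+ n) = (1 - c) * qpoch (c * q) q n.
  by rewrite -qpochSr qpochSl.
have n1 := qpoch_neq0 n q1w c1; have n2 := qpoch_neq0 n q1w cq1.
have n3 := qpochqq_neq0 n; have n4 := qpochqq_neq0 n.+1.
have n5 := qpoch_neq0 n.+1 q1w c1.
move: n4 n5; rewrite !qpochSr -exprS !mulf_eq0 !negb_or => /andP[_ n4] /andP[_ n5].
have n6 : 1 - c != 0.
  by have := qpoch_neq0 1 q1w c1; rewrite /qpoch big_ord1 expr0 mulr1.
have -> : qpoch (c * q) q n = qpoch c q n * (1 - c * q ^+ n) / (1 - c).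
  by rewrite e1 mulrAC divff // mul1r.
move: n4; rewrite exprS => n4.
rewrite (exprS (-1)).
move: (q ^+ n) ((-1) ^+ n) n4 n5 => A B n4 n5.
by field; rewrite n1 n3 n4 n5 n6.
Qed.

Lemma prod_bin2 n : \prod_(k < n) q ^+ k = q ^+ 'C(n, 2).
Proof.
elim: n => [|n IH]; first by rewrite big_ord0.
by rewrite big_ord_recr /= IH bin2S exprD.
Qed.

(** The contiguous relation, iterated N times, multiplies the sum by
    (z)_N / (c)_N and replaces (z, c) by (z q^N, c q^N); all terms but the first
    tend to 0 as N grows. *)
Lemma phi11_sum z c : `|c| < 1 ->
  has_sum (phi11 z c) (qpoch_inf z q / qpoch_inf c q).
Proof.
move=> c1.
have cN N : `|c * q ^+ N| <= `|c|.
  by rewrite normrM normrX ler_piMr // exprn_ile1.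
have cN1 N : `|c * q ^+ N| < 1 by exact: le_lt_trans (cN N) c1.
have /choice [s hs] : forall N, exists s, has_sum (phi11 (z * q ^+ N) (c * q ^+ N)) s.
  by move=> N; apply/Kc/abs_bounded_phi11.
have rec N : qpoch c q N * s 0%N = qpoch z q N * s N.
  elim: N => [|N IH]; first by rewrite !qpoch0.
  rewrite !qpochSr mulrAC IH -!mulrA; congr (_ * _).
  rewrite mulrC; apply: phi11_shift (cN1 N) (hs N) _.
  by rewrite -!mulrA -!exprSr.
have slim : s N @[N --> \oo] --> (1 : K).
  have [C C0 hC] := phi11_bounded (normr_ge0 c) c1.
  pose X := `|z| + `|c|.
  have X0 : 0 <= X by rewrite addr_ge0.
  have hX N : `|z * q ^+ N| + `|c * q ^+ N| = X * `|q| ^+ N.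
    by rewrite !normrM !normrX -mulrDl.
  apply: (@has_sum_cvg _ _ (fun N => phi11 (z * q ^+ N) (c * q ^+ N))
    (fun n => (n == 0%N)%:R) (fun n => C * (`|q| ^+ 'C(n, 2) * X ^+ n)) s 1) => //.
  - move=> N n; apply: le_trans (hC _ _ _ (cN N)) _.
    rewrite ler_wpM2l // ler_wpM2l ?exprn_ge0 // hX lerXn2r ?nnegrE ?mulr_ge0 ?exprn_ge0 //.
    by rewrite ler_piMr // exprn_ile1.
  - case=> [|n]; last by rewrite normr0 !mulr_ge0 ?exprn_ge0.
    have := hC 0 0 0%N; rewrite normr0 => /(_ (normr_ge0 c)).
    by rewrite phi11_0 bin0n /= !expr0 !mulr1.
  - apply: (@abs_bounded_dom _ _ _ (fun n => `|q| ^+ 'C(n, 2) * X ^+ n) C) => //.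
      by move=> n; rewrite normrM (ger0_norm C0).
    exact: abs_bounded_bin2.
  - case=> [|n].
      have -> : (fun N => phi11 (z * q ^+ N) (c * q ^+ N) 0) = fun=> 1.
        by apply/funext => N; rewrite phi11_0.
      exact: cvg_cst.
    apply: (@cvg0_expr_bound _ `|q| (C * X ^+ n.+1)) => //.
      by rewrite mulr_ge0 ?exprn_ge0.
    move=> N; apply: le_trans (hC _ _ _ (cN N)) _.
    rewrite -mulrA ler_wpM2l // hX exprMn mulrCA ler_wpM2l ?exprn_ge0 //.
    apply: (@le_trans _ _ ((`|q| ^+ N) ^+ n.+1)).
      by rewrite ler_piMl ?exprn_ge0 // exprn_ile1.
    by rewrite exprS ler_piMr ?exprn_ge0 // exprn_ile1 // exprn_ile1.
  - have := @has_sum_ord K (fun n => (n == 0%N)%:R) 1%N.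
    by rewrite big_ord1 /=; apply; case.
have c0 : qpoch_inf c q != 0 by exact: qpoch_inf_neq0.
have e : qpoch_inf c q * s 0%N = qpoch_inf z q * 1.
  apply: (@cvg_seq_uniq _ (fun N => qpoch c q N * s 0%N)).
    by apply: cvgMl; exact: (qpoch_cvg Kc _ q1).
  under eq_fun => N do rewrite rec.
  by apply: cvgM => //; exact: (qpoch_cvg Kc _ q1).
have := hs 0%N; rewrite expr0 !mulr1.
have -> // : s 0%N = qpoch_inf z q / qpoch_inf c q.
by apply: (mulfI c0); rewrite e mulr1 mulrC divfK.
Qed.

End QSeries.
Arguments phi11_sum {K} Kc {q} q1 z [c] _.

(** * The identities of Euler, Cauchy and Lebesgue *)

Section Specializations.
Variable K : numFieldType.
Hypothesis Kc : abs_complete K.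
Variable q : K.
Hypothesis q1 : `|q| < 1.
Implicit Types (a c x z : K).

Let q1w : `|q| <= 1. Proof. exact: ltW. Qed.

(** 1 / (q)_k extended by 0 to negative k.  This extension obeys the recurrence
    of qfac_inv_rec on all of Z and cuts off sums at their natural bounds. *)
Definition qfac_inv (k : int) : K :=
  if k is Posz n then (qpoch q q n)^-1 else 0.

Lemma qpoch_0 n : qpoch 0 q n = 1.
Proof. by rewrite /qpoch big1 // => k _; rewrite mul0r subr0. Qed.

Lemma qpoch_inf_0 : qpoch_inf 0 q = 1.
Proof.
apply: qpoch_inf_lim => //; have -> : qpoch 0 q = fun=> 1.
  by apply/funext => n; exact: qpoch_0.
exact: cvg_cst.
Qed.

Lemma euler_phi11 x :
  phi11 q (- x) 0 =1 (fun n => q ^+ 'C(n, 2) * x ^+ n * qfac_inv n).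
Proof.
move=> n; rewrite /phi11 qpoch_0 mulr1 /=; congr (_ / _).
under eq_bigr => k _ do rewrite mul0r subr0.
by rewrite prodr_const card_ord mulrAC -exprMn mulrN mulN1r opprK mulrC.
Qed.

(** The case c = 0 of phi11_sum. *)
Lemma euler_sum x :
  has_sum (fun n : nat => q ^+ 'C(n, 2) * x ^+ n * qfac_inv n) (qpoch_inf (- x) q).
Proof.
apply: eq_has_sum (euler_phi11 x) _.
have := @phi11_sum _ Kc _ q1 (- x) 0; rewrite normr0 qpoch_inf_0 divr1.
by apply; exact: ltr01.
Qed.

Lemma abs_bounded_euler x :
  abs_bounded (fun n : nat => q ^+ 'C(n, 2) * x ^+ n * qfac_inv n).
Proof.
rewrite -(funext (euler_phi11 x)); apply: abs_bounded_phi11 => //.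
by rewrite normr0.
Qed.

(** The case z = 0, c = q^(m+1) of phi11_sum: the count of partitions by
    their Durfee rectangle. *)
Lemma cauchy_sum_nat m :
  has_sum (fun n : nat => q ^+ (n * (n + m)) * qfac_inv n * qfac_inv (n + m)%N)
          (qpoch_inf q q)^-1.
Proof.
have c1 : `|q ^+ m.+1| < 1 by rewrite normrX exprn_ilt1.
have h : qpoch_inf q q = qpoch q q m * qpoch_inf (q ^+ m.+1) q.
  by rewrite (qpoch_infD Kc _ m q1) exprS.
have h0 : qpoch_inf 0 q = 1 := qpoch_inf_0.
have := has_sumZ (c := (qpoch q q m)^-1) (phi11_sum Kc q1 0 c1).
rewrite h0 div1r -invfM -h; apply: eq_has_sum => n.
rewrite /phi11 /= [(n + m)%N]addnC qpochD -exprS.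
under eq_bigr => k _ do rewrite sub0r.
rewrite prodrN card_ord big_split /= prodr_const card_ord prod_bin2.
have -> : (n * (m + n))%N = ('C(n, 2) + (m.+1 * n + 'C(n, 2)))%N.
  by rewrite mulnDr sqrn_bin2; lia.
rewrite exprD (exprD q (m.+1 * n)) exprM !invfM.
have -> : (-1) ^+ n * q ^+ 'C(n, 2) * ((-1) ^+ n * (q ^+ m.+1 ^+ n * q ^+ 'C(n, 2))) =
  q ^+ 'C(n, 2) * (q ^+ m.+1 ^+ n * q ^+ 'C(n, 2)) * ((-1) ^+ n * (-1) ^+ n) by ring.
rewrite -expr2 sqrr_sign mulr1; ring.
Qed.

(** For negative m the terms with n < -m vanish, and shifting n by -m gives the
    sum for -m. *)
Lemma cauchy_sum (m : int) : q != 0 ->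
  has_sum (fun n : nat => q ^ (n%:Z * (n%:Z + m)) * qfac_inv n * qfac_inv (n%:Z + m))
          (qpoch_inf q q)^-1.
Proof.
move=> q0; case: m => m.
  by apply: eq_has_sum (cauchy_sum_nat m) => n; rewrite -PoszD -PoszM -exprnP.
apply/(@has_sum_reindex _ _ _ (fun n => (n + m.+1)%N)).
- exact: addIn.
- move=> n nN; have nm : (n < m.+1)%N.
    by rewrite ltnNge; apply/negP => h; apply: (nN (n - m.+1)%N); rewrite subnK.
  have -> : n%:Z + Negz m = Negz (m - n) by rewrite !NegzE; lia.
  by rewrite /= mulr0.
apply: eq_has_sum (cauchy_sum_nat m.+1) => n /=.
have -> : (n + m.+1)%N%:Z + Negz m = n by rewrite NegzE; lia.
by rewrite -PoszM -exprnP mulrAC mulnC.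
Qed.

Definition lebesgue_term a n : K := qpoch a q n * q ^+ 'C(n.+1, 2) * qfac_inv n.

Lemma lebesgue_bounded (x : K) : 0 <= x -> exists2 C, 0 <= C &
  forall a n, `|a| <= x -> `|lebesgue_term a n| <= C * (`|q| ^+ 'C(n, 2) * `|q| ^+ n).
Proof.
move=> x0.
have [B1 hB1] := qpoch_bounded Kc q1 x0.
have [B2 hB2] := qpochV_bounded Kc q1 (normr_ge0 q) q1.
have B10 : 0 <= B1 by apply: le_trans (hB1 0 0%N _) => //; rewrite normr0.
have B20 : 0 <= B2 by apply: le_trans (hB2 q 0%N _).
exists (B1 * B2); first exact: mulr_ge0.
move=> a n ax; rewrite /lebesgue_term !normrM normrX bin2S exprD.
rewrite mulrAC ler_wpM2r ?mulr_ge0 ?exprn_ge0 //; apply: ler_pM => //.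
  exact: hB1.
exact: hB2.
Qed.

Lemma abs_bounded_lebesgue a : abs_bounded (lebesgue_term a).
Proof.
have [C C0 hC] := lebesgue_bounded (normr_ge0 a).
apply: (@abs_bounded_dom _ _ _ (fun n => `|q| ^+ 'C(n, 2) * `|q| ^+ n) C) => //.
  move=> n; apply: le_trans (hC _ _ (lexx _)) _.
  by rewrite [X in _ <= _ * X]ger0_norm // mulr_ge0 ?exprn_ge0.
exact: abs_bounded_bin2.
Qed.

(** As for phi11_shift, the difference telescopes; here V is built from the general
    term at a q. *)
Lemma lebesgue_shift a s t : has_sum (lebesgue_term a) s ->
  has_sum (lebesgue_term (a * q ^+ 2)) t -> s = (1 - a * q) * t.
Proof.
move=> hs ht.
pose V n := if n is m.+1 then - (a * (q ^+ m.+1 * lebesgue_term (a * q) m)) else 0.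
have hV : has_sum (fun n => V n - V n.+1) 0.
  apply: has_sum_telescope => //; apply: (@abs_bounded_shift _ _ 1).
  apply: (@abs_bounded_dom _ _ _ (lebesgue_term (a * q)) `|a|) => //.
    move=> n; rewrite add1n /= normrN !normrM ler_wpM2l // ler_piMl //.
    by rewrite normrX exprn_ile1.
  exact: abs_bounded_lebesgue.
apply/eqP; rewrite -subr_eq0; apply/eqP; apply: has_sum_uniq hV.
have := has_sumB hs (has_sumZ (c := 1 - a * q) ht).
apply: eq_has_sum => -[|n]; rewrite /V /lebesgue_term.
  by rewrite /= !qpoch0 !expr0 invr1 /= !expr1; ring.
rewrite qpochSl /=.
have n3 := qpochqq_neq0 q1 n; have := qpochqq_neq0 q1 n.+1.
rewrite (qpochSr q) mulf_eq0 negb_or => /andP[_ n4].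
have e : (1 - a * q) * qpoch (a * q ^+ 2) q n.+1 =
    qpoch (a * q) q n * (1 - a * q * q ^+ n) * (1 - a * q * (q * q ^+ n)).
  by rewrite expr2 mulrA -qpochSl !qpochSr -exprS.
rewrite (mulrA (1 - a * q)) (mulrA (1 - a * q)) e (qpochSr (a * q)).
rewrite (bin2S n.+1) exprD !exprS.
move: (q ^+ n) n4 => A n4.
by field; rewrite n3 n4.
Qed.

(** Iterating the shift reduces to a = 0, which is Euler's sum at x = q. *)
Lemma lebesgue_sum a :
  has_sum (lebesgue_term a) (qpoch_inf (a * q) (q ^+ 2) * qpoch_inf (- q) q).
Proof.
have q21 : `|q ^+ 2| < 1 by rewrite normrX exprn_ilt1.
have /choice [s hs] : forall N, exists s, has_sum (lebesgue_term (a * (q ^+ 2) ^+ N)) s.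
  by move=> N; apply/Kc/abs_bounded_lebesgue.
have rec N : s 0%N = qpoch (a * q) (q ^+ 2) N * s N.
  elim: N => [|N IH]; first by rewrite qpoch0 mul1r.
  rewrite qpochSr IH -!mulrA; congr (_ * _).
  have -> : a * (q * q ^+ 2 ^+ N) = a * q ^+ 2 ^+ N * q by ring.
  apply: lebesgue_shift (hs N) _.
  by rewrite -!mulrA -!exprSr.
have aN N : `|a * q ^+ 2 ^+ N| <= `|a|.
  by rewrite normrM normrX ler_piMr // exprn_ile1 // ltW.
have hE : has_sum (lebesgue_term 0) (qpoch_inf (- q) q).
  apply: eq_has_sum (@euler_sum q) => n.
  by rewrite /lebesgue_term qpoch_0 mul1r bin2S exprD.
have slim : s N @[N --> \oo] --> qpoch_inf (- q) q.
  have [C C0 hC] := lebesgue_bounded (normr_ge0 a).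
  apply: (@has_sum_cvg _ _ (fun N => lebesgue_term (a * q ^+ 2 ^+ N)) (lebesgue_term 0)
    (fun n => C * (`|q| ^+ 'C(n, 2) * `|q| ^+ n)) s) => //.
  - by move=> N n; exact: hC.
  - by move=> n; apply: hC; rewrite normr0.
  - apply: (@abs_bounded_dom _ _ _ (fun n => `|q| ^+ 'C(n, 2) * `|q| ^+ n) C) => //.
      by move=> n; rewrite normrM (ger0_norm C0).
    exact: abs_bounded_bin2.
  - move=> n; rewrite /lebesgue_term.
    apply: cvgMl; apply: cvgMl; rewrite /qpoch.
    apply: cvg_big; first exact: mul_continuous.
    move=> k _; apply: cvgB; first exact: cvg_cst.
    apply: cvgMl; rewrite -[X in _ --> X](mulr0 a); apply: cvgMr.
    apply: (@cvg0_expr_bound _ `|q ^+ 2| 1) => // N.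
    by rewrite mul1r normrX.
have := hs 0%N; rewrite expr0 mulr1.
have -> // : s 0%N = qpoch_inf (a * q) (q ^+ 2) * qpoch_inf (- q) q.
apply: (@cvg_seq_uniq _ (fun=> s 0%N)); first exact: cvg_cst.
under eq_fun => N do rewrite (rec N).
by apply: cvgM => //; exact: qpoch_cvg.
Qed.

End Specializations.

Arguments qfac_inv {K} q k : simpl never.
Arguments lebesgue_term {K} q a n.
Arguments abs_bounded_euler {K} Kc {q} q1 x.
Arguments euler_sum {K} Kc {q} q1 x.
Arguments cauchy_sum {K} Kc {q} q1 m _.
Arguments lebesgue_sum {K} Kc {q} q1 a.

(** * Theta functions *)

Section Theta.
Variable K : numFieldType.
Hypothesis Kc : abs_complete K.

(** The bounds guarantee that the double sum exists; Fubini then gives its value. *)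
Lemma has_sum_prod (I J : choiceType) (f : I -> K) (g : J -> K) s t :
  abs_bounded f -> abs_bounded g -> has_sum f s -> has_sum g t ->
  has_sum (fun x : I * J => f x.1 * g x.2) (s * t).
Proof.
move=> fb gb hs ht.
have [S hS] := Kc (abs_bounded_prod fb gb).
have h1 : has_sum (fun i => t * f i) S.
  apply: has_sum_fiber hS _ => i /=; rewrite mulrC.
  exact: has_sumZ.
by have := has_sum_uniq h1 (has_sumZ (c := t) hs); rewrite mulrC => <-.
Qed.

Variable q : K.
Hypothesis q1 : `|q| < 1.
Hypothesis q0 : q != 0.
Local Notation iq := (qfac_inv q).

Lemma qfac_inv_rec (k : int) : (1 - q ^ k) * iq k = iq (k - 1).
Proof.
case: k => [[|n]|n]; first by rewrite subrr mul0r.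
  have -> : n.+1%:Z - 1 = n by lia.
  rewrite /qfac_inv -exprnP qpochSr invfM -exprS mulrC -mulrA mulVf ?mulr1 //.
  have := qpochqq_neq0 q1 n.+1.
  by rewrite qpochSr mulf_eq0 negb_or exprS => /andP[].
have -> : Negz n - 1 = Negz n.+1 by rewrite !NegzE; lia.
by rewrite mulr0.
Qed.

Lemma qfac_inv_lt0 (k : int) : k < 0 -> iq k = 0.
Proof. by case: k. Qed.

(** Induction on b, by the q-Pascal recurrence: writing
    1 - q^(b+1) = (1 - q^s) + q^s (1 - q^(b+1-s)), the first part lowers s, b - s
    stays, and the second part lowers b - s.  Letting c be any integer makes the
    induction hypothesis available at c - 1 when c = 0. *)
Lemma qfac_inv_mul_sum (b : nat) (c : int) :
  has_sum (fun s : nat => q ^ ((b%:Z - s%:Z) * (c - s%:Z)) *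
     iq s * iq (b%:Z - s%:Z) * iq (c - s%:Z)) (iq b * iq c).
Proof.
elim: b c => [|b IH] c.
  set f := (f in has_sum f _).
  have -> : iq 0%N * iq c = \sum_(s < 1) f s.
    by rewrite big_ord1 /f !subr0 mul0r expr0z mul1r /qfac_inv qpoch0 invr1 !mul1r.
  apply: has_sum_ord => s s1; rewrite /f (@qfac_inv_lt0 (0%:Z - s%:Z)) ?mulr0 ?mul0r //.
  lia.
pose t (b : nat) c (s : nat) := q ^ ((b%:Z - s%:Z) * (c - s%:Z)) *
     iq s * iq (b%:Z - s%:Z) * iq (c - s%:Z).
pose A (s : nat) := if s is s'.+1 then t b (c - 1) s' else 0.
have hA : has_sum A (0 + iq b * iq (c - 1)).
  by apply: (@has_sum_shift _ A); exact: IH.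
have := has_sumZ (c := (1 - q ^ b.+1)^-1) (has_sumD hA (has_sumZ (c := q ^ c) (IH c))).
have b1 : 1 - q ^+ b.+1 != 0.
  have := qpochqq_neq0 q1 b.+1.
  by rewrite qpochSr mulf_eq0 negb_or exprS => /andP[].
have -> : (1 - q ^ b.+1)^-1 * (0 + iq b * iq (c - 1) + q ^ c * (iq b * iq c)) =
   iq b.+1 * iq c.
  rewrite -(qfac_inv_rec c) /qfac_inv qpochSr -/(qfac_inv q c) -exprS exprnP.
  have := qpochqq_neq0 q1 b; move: b1; rewrite exprnP => b1 h.
  by field; rewrite b1 h.
apply: eq_has_sum => s /=.
apply: (mulfI b1); rewrite exprnP mulrA divff ?mul1r; last by rewrite -exprnP.
have -> : 1 - q ^ b.+1 = (1 - q ^ s%:Z) + q ^ s%:Z * (1 - q ^ (b.+1%:Z - s%:Z)).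
  have -> : q ^ b.+1 = q ^ s%:Z * q ^ (b.+1%:Z - s%:Z).
    by rewrite -expfzDr //; congr (_ ^ _); lia.
  ring.
have e1 := qfac_inv_rec s; have e2 := qfac_inv_rec (b.+1%:Z - s%:Z).
have e3 : b.+1%:Z - s%:Z - 1 = b%:Z - s%:Z by lia.
rewrite [RHS]mulrDl; congr (_ + _).
  rewrite [RHS](_ : _ = q ^ ((b.+1%:Z - s%:Z) * (c - s%:Z)) * ((1 - q ^ s%:Z) * iq s) *
     iq (b.+1%:Z - s%:Z) * iq (c - s%:Z)); last by ring.
  rewrite e1 /A; case: s {e1 e2 e3} => [|s].
    by rewrite sub0r (@qfac_inv_lt0 (- 1)) // mulr0 !mul0r.
  rewrite /t; have -> : s.+1%:Z - 1 = s%:Z by lia.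
  have -> : b.+1%:Z - s.+1%:Z = b%:Z - s%:Z by lia.
  by have -> : c - s.+1%:Z = c - 1 - s%:Z by lia.
rewrite [RHS](_ : _ = q ^ s%:Z * q ^ ((b.+1%:Z - s%:Z) * (c - s%:Z)) * iq s *
   ((1 - q ^ (b.+1%:Z - s%:Z)) * iq (b.+1%:Z - s%:Z)) * iq (c - s%:Z)); last by ring.
rewrite e2 e3 !mulrA -!expfzDr //; congr (q ^ _ * _ * _ * _).
have -> : b.+1%:Z = b%:Z + 1 by lia.
ring.
Qed.

(** The m extra factors 1 + Y / q^k are turned around, as (Y / q^k)(1 + q^k / Y). *)
Lemma qpoch_inf_shift_neg (Y : K) m : Y != 0 ->
  qpoch_inf (- (Y / q ^+ m)) q =
  Y ^+ m / q ^+ 'C(m.+1, 2) * qpoch (- (q / Y)) q m * qpoch_inf (- Y) q.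
Proof.
move=> Y0; elim: m => [|m IH]; first by rewrite !expr0 qpoch0 !divr1 !mul1r.
rewrite (qpoch_infD Kc _ 1 q1) /qpoch big_ord1 expr0 mulr1 expr1.
have -> : - (Y / q ^+ m.+1) * q = - (Y / q ^+ m).
  by rewrite exprS; field; rewrite q0 expf_neq0.
rewrite IH -/(qpoch _ _ _) qpochSr (bin2S m.+1) exprD !exprS.
rewrite opprK.
have qm : q ^+ m != 0 by rewrite expf_neq0.
have qC : q ^+ 'C(m.+1, 2) != 0 by rewrite expf_neq0.
move: (q ^+ m) (q ^+ 'C(m.+1, 2)) (qpoch (- (q / Y)) q m) qm qC => A B C qm qC.
by field; rewrite qm qC Y0 q0.
Qed.

(** Quasi-periodicity of the theta function. *)
Lemma theta_shift (Y : K) m : Y != 0 ->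
  qpoch_inf (- (Y / q ^+ m)) q * qpoch_inf (- (q ^+ m.+1 / Y)) q =
  Y ^+ m / q ^+ 'C(m.+1, 2) * (qpoch_inf (- Y) q * qpoch_inf (- (q / Y)) q).
Proof.
move=> Y0; rewrite qpoch_inf_shift_neg // [qpoch_inf (- (q / Y)) q](qpoch_infD Kc _ m q1).
have -> : - (q / Y) * q ^+ m = - (q ^+ m.+1 / Y) by rewrite exprS; ring.
ring.
Qed.

End Theta.

Section Jacobi.
Variable K : numFieldType.
Hypothesis Kc : abs_complete K.
Variable q : K.
Hypothesis q1 : `|q| < 1.
Hypothesis q0 : q != 0.

(** The two infinite products in x are Euler sums over a and b, and
    a^2 + b^2 = n^2 + 2 b (b + n) for n = a - b, so that for fixed n the sum over
    b is Cauchy's. *)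
Lemma jacobi_sum (x : K) : x != 0 ->
  has_sum (fun n : int => q ^ (n * n) * x ^ n)
   (qpoch_inf (q ^+ 2) (q ^+ 2) *
    (qpoch_inf (- (q * x)) (q ^+ 2) * qpoch_inf (- (q / x)) (q ^+ 2))).
Proof.
move=> x0.
have q21 : `|q ^+ 2| < 1 by rewrite normrX exprn_ilt1.
have q20 : q ^+ 2 != 0 by rewrite expf_neq0.
pose iq := qfac_inv (q ^+ 2).
have hP := has_sum_prod Kc (abs_bounded_euler Kc q21 (q * x))
  (abs_bounded_euler Kc q21 (q / x)) (euler_sum Kc q21 (q * x)) (euler_sum Kc q21 (q / x)).
pose F (y : int * nat) := q ^ (y.1 * y.1) * x ^ y.1 *
  ((q ^+ 2) ^ (y.2%:Z * (y.2%:Z + y.1)) * iq y.2 * iq (y.2%:Z + y.1)).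
pose h (y : nat * nat) : int * nat := (y.1%:Z - y.2%:Z, y.2).
have hF : has_sum F (qpoch_inf (- (q * x)) (q ^+ 2) * qpoch_inf (- (q / x)) (q ^+ 2)).
  apply/(@has_sum_reindex _ _ _ h).
  - by move=> [a b] [a' b'] [] /[swap] -> /addIr [->].
  - move=> [n b] nim; rewrite /F /=.
    rewrite /iq (@qfac_inv_lt0 _ _ (b%:Z + n)) ?mulr0 //.
    rewrite ltNge; apply/negP => bn.
    have : h (absz (b%:Z + n), b) = (n, b) by rewrite /h /= gez0_abs // addrC addKr.
    exact: nim.
  apply: eq_has_sum hP => -[a b]; rewrite /F /h /=.
  have -> : b%:Z + (a%:Z - b%:Z) = a by ring.
  have -> : (q ^+ 2) ^ (b%:Z * a%:Z) = q ^ (2 * (b%:Z * a%:Z)).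
    by rewrite exprnP exprz_exp.
  have -> : x ^ (a%:Z - b%:Z) = x ^+ a * (x^-1) ^+ b.
    by rewrite expfzDr // -exprz_inv.
  have e (c : nat) y : (q ^+ 2) ^+ 'C(c, 2) * (q * y) ^+ c = q ^ (c%:Z * c%:Z) * y ^+ c.
    by rewrite -PoszM -exprnP sqrn_bin2 exprD exprM [(q * y) ^+ c]exprMn; ring.
  rewrite !e.
  rewrite (_ : q ^ (a%:Z * a%:Z) * _ * _ * _ = q ^ (a%:Z * a%:Z) * q ^ (b%:Z * b%:Z) *
     (x ^+ a * x^-1 ^+ b * iq a * iq b)); last by rewrite /iq; ring.
  rewrite [RHS](_ : _ = q ^ ((a%:Z - b%:Z) * (a%:Z - b%:Z)) * q ^ (2 * (b%:Z * a%:Z)) *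
     (x ^+ a * x^-1 ^+ b * iq a * iq b)); last by ring.
  by rewrite -!expfzDr //; congr (q ^ _ * _); ring.
have := has_sum_fiber hF (fun n => has_sumZ (c := q ^ (n * n) * x ^ n) (cauchy_sum Kc q21 n q20)).
move=> /(has_sumZ (c := qpoch_inf (q ^+ 2) (q ^+ 2))).
apply: eq_has_sum => n; rewrite mulrC mulrAC -mulrA divff ?mulr1 //.
exact: qpoch_inf_neq0.
Qed.

End Jacobi.

(** * The five-fold sum above the tadpole sum *)

Lemma int_double_inj (k l : int) : 2 * k = 2 * l -> k = l.
Proof. lia. Qed.

(** The triangular exponents as integers: by triE their doubles are polynomials, so
    that identities between exponents become polynomial after doubling. *)
Definition tri (n : nat) : int := 'C(n, 2)%:Z.

Lemma triE n : 2 * tri n = n%:Z * n%:Z - n%:Z.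
Proof. by rewrite /tri -!PoszM (sqrn_bin2 n) PoszD addrK. Qed.

Lemma triSE n : 2 * tri n.+1 = n%:Z * n%:Z + n%:Z.
Proof. by rewrite triE -addn1 PoszD; ring. Qed.

(** The quadratic form of the tadpole diagram with its linear part. *)
Definition tadpole_exp (a b c d : nat) : int :=
  tri d + a%:Z * a%:Z + b%:Z * b%:Z + c%:Z * c%:Z
  - a%:Z * b%:Z - b%:Z * c%:Z - c%:Z * d%:Z + c%:Z + 2 * (a%:Z - b%:Z).

Section Tadpole.
Variable K : numFieldType.
Hypothesis Kc : abs_complete K.
Variables p y rho : K.
Hypothesis p0 : p != 0.
Hypothesis p1 : `|p| < 1.
Hypothesis y0 : y != 0.
Hypothesis rho_ge0 : 0 <= rho.
Hypothesis rhoE : rho ^+ 2 = `|p|.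
Local Notation iq := (qfac_inv p).

Definition tadpole_term (x : nat * nat * nat * nat) : K :=
  let '(d, b, a, c) := x in
  p ^ tadpole_exp a b c d * y ^ (d%:Z - c%:Z - (a%:Z - b%:Z)) *
  (iq d * iq b * iq a * iq c).

(** The term of the five-fold sum: the tadpole term at b = s + u, c = s + t, with
    the factor 1 / ((p)_b (p)_c) replaced by a term of qfac_inv_mul_sum. *)
Definition lifted_term (x : nat * nat * nat * nat * nat) : K :=
  let '(a, s, u, t, d) := x in
  p ^ (tadpole_exp a (s + u) (s + t) d + u%:Z * t%:Z) *
  y ^ (d%:Z - (s + t)%:Z - (a%:Z - (s + u)%:Z)) *
  (iq a * iq s * iq u * iq t * iq d).

Lemma rho_lt1 : rho < 1.
Proof.
rewrite -(@ltr_pXn2r _ 2) ?nnegrE ?ler01 // rhoE expr1n //.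
Qed.

Lemma rho_neq0 : rho != 0.
Proof. by rewrite -sqrf_eq0 rhoE normr_eq0. Qed.

Lemma normr_exprz (x : K) (k : int) : `|x ^ k| = `|x| ^ k.
Proof. by case: k => n; rewrite ?NegzE -?exprnN -?exprnP ?normfV normrX. Qed.

Definition theta_term (x : K) (k : int) := rho ^+ (`|k| * `|k|) * x ^ k.

Lemma theta_termE (x : K) k : theta_term x k = rho ^ (k * k) * x ^ k.
Proof. by rewrite /theta_term exprnP; congr (_ ^ _ * _); lia. Qed.

(** Twice the exponent of p is the sum of the squares of a, n = a - s - u, u, t and
    e = s + t - d, plus linear terms.  These five integers determine the indices,
    and the base of the theta series is the square root rho of the norm of p. *)
Lemma abs_bounded_lifted : abs_bounded lifted_term.
Proof.
have r0 : 0 < rho by rewrite lt_def rho_neq0.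
have y0' : 0 < `|y| by rewrite normr_gt0.
have theta_bounded x : 0 < x -> abs_bounded (theta_term x).
  by move=> x0; apply: abs_bounded_theta => //; exact: rho_lt1.
pose F (x : int * int * int * int * int) := theta_term rho x.1.1.1.1 *
  theta_term (rho ^+ 3 / `|y|) x.1.1.1.2 * theta_term rho^-1 x.1.1.2 * theta_term rho x.1.2 *
  theta_term (rho / `|y|) x.2.
have hF : abs_bounded F.
  apply: (@abs_bounded_prod _ _ _ (fun x : int * int * int * int => theta_term rho x.1.1.1 *
     theta_term (rho ^+ 3 / `|y|) x.1.1.2 * theta_term rho^-1 x.1.2 * theta_term rho x.2)); last first.
    by apply: theta_bounded; rewrite divr_gt0.
  apply: (@abs_bounded_prod _ _ _ (fun x : int * int * int => theta_term rho x.1.1 *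
     theta_term (rho ^+ 3 / `|y|) x.1.2 * theta_term rho^-1 x.2)); last exact: theta_bounded.
  apply: (@abs_bounded_prod _ _ _ (fun x : int * int => theta_term rho x.1 *
     theta_term (rho ^+ 3 / `|y|) x.2)); last by apply: theta_bounded; rewrite invr_gt0.
  by apply: abs_bounded_prod; apply: theta_bounded; rewrite // divr_gt0 ?exprn_gt0.
pose h (x : nat * nat * nat * nat * nat) : int * int * int * int * int :=
  let '(a, s, u, t, d) := x in
  (a%:Z, a%:Z - s%:Z - u%:Z, u%:Z, t%:Z, s%:Z + t%:Z - d%:Z).
have hI : injective h.
  move=> [[[[a s] u] t] d] [[[[a' s'] u'] t'] d'] [ea es eu et ed].
  by congr (_, _, _, _, _); lia.
have [B hB] := qpochV_bounded Kc p1 (normr_ge0 p) p1.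
have iqB n : `|iq n%:Z| <= B by exact: hB.
have B0 : 0 <= B by exact: le_trans (iqB 0%N).
apply: (@abs_bounded_dom _ _ _ (F \o h) (B * B * B * B * B)).
- by rewrite !mulr_ge0.
- move=> [[[[a s] u] t] d]; rewrite /lifted_term normrM mulrC.
  apply: ler_pM => //.
    rewrite !normrM; do 4!(apply: ler_pM; rewrite ?mulr_ge0 //).
  rewrite le_eqVlt; apply/orP; left; apply/eqP.
  rewrite normrM !normr_exprz -rhoE [RHS]ger0_norm; last first.
    have theta_ge0 x k : 0 <= x -> 0 <= theta_term x k.
      by move=> x0; rewrite mulr_ge0 ?exprn_ge0 ?exprz_ge0.
    have x1 : 0 <= rho ^+ 3 / `|y| by rewrite divr_ge0 ?exprn_ge0.
    have x2 : 0 <= rho / `|y| by rewrite divr_ge0.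
    have x3 : 0 <= rho^-1 by rewrite invr_ge0.
    by rewrite /F /h /=; do 4?[apply: mulr_ge0; last exact: theta_ge0]; exact: theta_ge0.
  have yn : `|y| != 0 by rewrite gt_eqF.
  have r0' := rho_neq0.
  rewrite /F /h /= !theta_termE (exprnP rho 2) (exprnP rho 3).
  rewrite !(expfzMl _ `|y|^-1) !exprz_inv !exprz_exp.
  have -> : d%:Z - (s + t)%N%:Z - (a%:Z - (s + u)%N%:Z) =
    - (a%:Z - s%:Z - u%:Z) - (s%:Z + t%:Z - d%:Z) by lia.
  rewrite (expfzDr _ _ yn).
  set Y1 := _ ^ (- _); set Y2 := _ ^ (- (_ - d%:Z)).
  set n := a%:Z - s%:Z - u%:Z; set e := s%:Z + t%:Z - d%:Z.
  transitivity (rho ^ (a%:Z * a%:Z) * rho ^ a%:Z * rho ^ (n * n) * rho ^ (3%N%:Z * n) *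
    rho ^ (u%:Z * u%:Z) * rho ^ (- u%:Z) * rho ^ (t%:Z * t%:Z) * rho ^ t%:Z *
    rho ^ (e * e) * rho ^ e * (Y1 * Y2)); last by ring.
  congr (_ * _); rewrite -!expfzDr //; congr (_ ^ _).
  have h1 := triE d; rewrite /tadpole_exp /n /e !PoszD.
  rewrite -[2%N%:Z]/(2 : int) -[3%N%:Z]/(3 : int).
  rewrite !mulrDr h1; ring.
- exact: abs_bounded_inj.
Qed.

(** Summing over s with b and c fixed undoes the lift. *)
Lemma lifted_sum_s S : has_sum lifted_term S -> has_sum tadpole_term S.
Proof.
move=> hS.
pose F (x : nat * nat * nat * nat * nat) : K :=
  let '(d, b, a, c, s) := x in
  p ^ tadpole_exp a b c d * y ^ (d%:Z - c%:Z - (a%:Z - b%:Z)) * (iq d * iq a) *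
  (p ^ ((b%:Z - s%:Z) * (c%:Z - s%:Z)) * iq s * iq (b%:Z - s%:Z) * iq (c%:Z - s%:Z)).
have hF : has_sum F S.
  apply/(@has_sum_reindex _ _ _ (fun x : nat * nat * nat * nat * nat =>
    let '(a, s, u, t, d) := x in (d, (s + u)%N, a, (s + t)%N, s))).
  - move=> [[[[a s] u] t] d] [[[[a' s'] u'] t'] d'] [ea es eu et ed].
    by congr (_, _, _, _, _); lia.
  - move=> [[[[d b] a] c] s] nim; rewrite /F.
    case: (leqP s b) => sb; last first.
      by rewrite (@qfac_inv_lt0 _ p (b%:Z - s%:Z)) ?mulr0 ?mul0r ?mulr0 //; lia.
    case: (leqP s c) => sc; last first.
      by rewrite (@qfac_inv_lt0 _ p (c%:Z - s%:Z)) ?mulr0 //; lia.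
    exfalso; apply: (nim (a, s, (b - s)%N, (c - s)%N, d)).
    by rewrite !subnKC.
  apply: eq_has_sum hS => -[[[[a s] u] t] d] /=.
  have -> : (s + u)%N%:Z - s%:Z = u by lia.
  have -> : (s + t)%N%:Z - s%:Z = t by lia.
  by rewrite [p ^ (_ + _)]expfzDr //; ring.
have hfib (x : nat * nat * nat * nat) : has_sum (fun s => F (x, s)) (tadpole_term x).
  case: x => [[[d b] a] c].
  have := has_sumZ (c := p ^ tadpole_exp a b c d * y ^ (d%:Z - c%:Z - (a%:Z - b%:Z)) * (iq d * iq a))
    (qfac_inv_mul_sum p1 p0 (b := b) (c := c)).
  have -> // : p ^ tadpole_exp a b c d * y ^ (d%:Z - c%:Z - (a%:Z - b%:Z)) * (iq d * iq a) * (iq b * iq c)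
    = tadpole_term (d, b, a, c).
  by rewrite /tadpole_term; ring.
exact: has_sum_fiber hF hfib.
Qed.

End Tadpole.

(** * Evaluation of the five-fold sum *)

Section TadpoleSum.
Variable K : numFieldType.
Hypothesis Kc : abs_complete K.
Variables p y : K.
Hypothesis p0 : p != 0.
Hypothesis p1 : `|p| < 1.
Hypothesis y0 : y != 0.
Local Notation iq := (qfac_inv p).
Local Notation P := (p ^+ 2).
Local Notation w := (- (p / y)).

Let P0 : P != 0. Proof. by rewrite expf_neq0. Qed.
Let P1 : `|P| < 1. Proof. by rewrite normrX exprn_ilt1. Qed.

(** The lifted term summed over d.  In the variables n and s the coupling of c to
    b has become n s + u a, and s and t have separated. *)
Definition sum_d (x : nat * nat * nat * nat) : K :=
  let '(a, s, u, t) := x in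
  let n := a%:Z - s%:Z - u%:Z in
  p ^ (n * n + n * s%:Z + u%:Z * a%:Z + tri s.+1 + tri t.+1 + 2 * n) * y ^ (- n) *
  (qpoch w p (s + t) * qpoch_inf (- y) p) * (iq a * iq s * iq u * iq t).

(** Euler's sum at y / p^c, whose c factors with negative powers of p are turned
    around by qpoch_inf_shift_neg. *)
Lemma lifted_sum_d (x : nat * nat * nat * nat) :
  has_sum (fun d => lifted_term p y (x, d)) (sum_d x).
Proof.
case: x => [[[a s] u] t].
set c := (s + t)%N; set n := a%:Z - s%:Z - u%:Z.
set E := a%:Z * a%:Z + (s + u)%N%:Z * (s + u)%N%:Z + c%:Z * c%:Z - a%:Z * (s + u)%N%:Z
   - (s + u)%N%:Z * c%:Z + u%:Z * t%:Z + c%:Z + 2 * n.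
have := has_sumZ (c := p ^ E * y ^ (- c%:Z - n) * (iq a * iq s * iq u * iq t))
  (euler_sum Kc p1 (y / p ^+ c)).
have -> : p ^ E * y ^ (- c%:Z - n) * (iq a * iq s * iq u * iq t) * qpoch_inf (- (y / p ^+ c)) p
   = sum_d (a, s, u, t).
  rewrite (qpoch_inf_shift_neg Kc p1 p0 _ y0) /sum_d -/n -/c.
  set E1 := n * n + _ + _ + _ + _ + _.
  have -> : p ^ E1 = p ^ E / p ^+ 'C(c.+1, 2).
    rewrite exprnN -expfzDr //; congr (p ^ _); apply: int_double_inj.
    rewrite -/(tri c.+1) /E1 /E /n !mulrDr !mulrN !triSE /c !PoszD; ring.
  have -> : y ^ (- n) = y ^ (- c%:Z - n) * y ^+ c.
    by rewrite [y ^+ c]exprnP -expfzDr //; congr (y ^ _); ring.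
  ring.
apply: eq_has_sum => d; rewrite /lifted_term.
have -> : tadpole_exp a (s + u) c d + u%:Z * t%:Z = E + tri d - c%:Z * d%:Z.
  by rewrite /tadpole_exp /E /n PoszD; ring.
have -> : d%:Z - c%:Z - (a%:Z - (s + u)%N%:Z) = - c%:Z - n + d%:Z.
  by rewrite /n PoszD; ring.
clearbody E n.
rewrite !(expfzDr _ _ p0) !(expfzDr _ _ y0) expr_div_n -exprM -PoszM -!exprnN.
by rewrite /tri -!exprnP; ring.
Qed.

(** The suffix lists the variables over which the lifted term has been summed. *)
Definition sum_du (x : nat * int * nat) : K :=
  let '(s, n, t) := x in
  p ^ (n * n + n * s%:Z + tri s.+1 + 2 * n) * y ^ (- n) *
  (qpoch w p s * lebesgue_term p (w * p ^+ s) t * qpoch_inf (- y) p) * iq s / qpoch_inf p p.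

(** With n fixed, a = u + n + s, so the exponent u a is that of Cauchy's sum; the
    constraint a >= 0 is built into qfac_inv. *)
Lemma sum_d_sum_u S : has_sum sum_d S -> has_sum sum_du S.
Proof.
move=> hS.
pose F (x : nat * int * nat * nat) : K :=
  let '(s, n, t, u) := x in
  p ^ (n * n + n * s%:Z + tri s.+1 + tri t.+1 + 2 * n) * y ^ (- n) *
  (qpoch w p (s + t) * qpoch_inf (- y) p) * (iq s * iq t) *
  (p ^ (u%:Z * (u%:Z + (n + s%:Z))) * iq u * iq (u%:Z + (n + s%:Z))).
have hF : has_sum F S.
  apply/(@has_sum_reindex _ _ _ (fun x : nat * nat * nat * nat =>
    let '(a, s, u, t) := x in (s, a%:Z - s%:Z - u%:Z, t, u))).
  - move=> [[[a s] u] t] [[[a' s'] u'] t'] [es ea et eu].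
    by congr (_, _, _, _); lia.
  - move=> [[[s n] t] u] nim; rewrite /F.
    case: (ltP (u%:Z + (n + s%:Z)) 0) => h; first by rewrite (qfac_inv_lt0 p h) !mulr0.
    exfalso; apply: (nim (absz (u%:Z + (n + s%:Z)), s, u, t)).
    by rewrite gez0_abs //; congr (_, _, _, _); ring.
  apply: eq_has_sum hS => -[[[a s] u] t] /=.
  set n := a%:Z - s%:Z - u%:Z.
  have -> : u%:Z + (n + s%:Z) = a by rewrite /n; ring.
  set X := n * n + _ + _ + _ + _ + _.
  have -> : X = n * n + n * s%:Z + tri s.+1 + tri t.+1 + 2 * n + u%:Z * a%:Z.
    by rewrite /X; ring.
  by rewrite [p ^ (_ + u%:Z * a%:Z)]expfzDr //; ring.
apply: has_sum_fiber hF _ => -[[s n] t] /=.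
have := has_sumZ (c := p ^ (n * n + n * s%:Z + tri s.+1 + tri t.+1 + 2 * n) * y ^ (- n) *
  (qpoch w p (s + t) * qpoch_inf (- y) p) * (iq s * iq t))
  (cauchy_sum Kc p1 (n + s%:Z) p0).
congr (has_sum _ _); rewrite /sum_du /lebesgue_term qpochD.
set X := n * n + _ + _ + _ + _.
have -> : X = n * n + n * s%:Z + tri s.+1 + 2 * n + tri t.+1 by rewrite /X; ring.
by rewrite [p ^ (_ + tri t.+1)]expfzDr // /tri -exprnP; ring.
Qed.

Definition sum_dut (x : nat * int) : K :=
  let '(s, n) := x in
  p ^ (n * n) * (p ^+ s.+2 / y) ^ n *
  (p ^+ 'C(s.+1, 2) * qpoch w p s * qpoch_inf (w * p ^+ s.+1) P * iq s *
   (qpoch_inf (- y) p * qpoch_inf (- p) p / qpoch_inf p p)).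

(** (w)_(s+t) = (w)_s (w p^s)_t, so the sum over t is Lebesgue's. *)
Lemma sum_du_sum_t S : has_sum sum_du S -> has_sum sum_dut S.
Proof.
move=> hS; apply: has_sum_fiber hS _ => -[s n] /=.
have := has_sumZ (c := p ^ (n * n + n * s%:Z + tri s.+1 + 2 * n) * y ^ (- n) *
  (qpoch w p s * qpoch_inf (- y) p) * iq s / qpoch_inf p p) (lebesgue_sum Kc p1 (w * p ^+ s)).
have -> : p ^ (n * n + n * s%:Z + tri s.+1 + 2 * n) * y ^ (- n) *
  (qpoch w p s * qpoch_inf (- y) p) * iq s / qpoch_inf p p *
  (qpoch_inf (w * p ^+ s * p) P * qpoch_inf (- p) p) = sum_dut (s, n).
  have -> : w * p ^+ s * p = w * p ^+ s.+1 by rewrite exprSr mulrA.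
  rewrite /sum_dut (expfzMl _ y^-1) exprz_inv [p ^+ s.+2]exprnP exprz_exp.
  have -> : n * n + n * s%:Z + tri s.+1 + 2 * n = n * n + s.+2%:Z * n + tri s.+1.
    have -> : s.+2%:Z = s%:Z + 2 by lia.
    ring.
  by rewrite !expfzDr // /tri -exprnP; ring.
by apply: eq_has_sum => t /=; ring.
Qed.

(** The triple product at x = p^(s+2) / y. *)
Definition theta_value (s : nat) : K := qpoch_inf P P *
    (qpoch_inf (- (p * (p ^+ s.+2 / y))) P * qpoch_inf (- (p / (p ^+ s.+2 / y))) P).

Definition sum_dutn (s : nat) : K :=
  p ^+ 'C(s.+1, 2) * qpoch w p s * qpoch_inf (w * p ^+ s.+1) P * iq s *
   (qpoch_inf (- y) p * qpoch_inf (- p) p / qpoch_inf p p) * theta_value s.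

(** The sum over n is a Jacobi theta series at x = p^(s+2) / y. *)
Lemma sum_dut_sum_n S : has_sum sum_dut S -> has_sum sum_dutn S.
Proof.
move=> hS; apply: has_sum_fiber hS _ => s /=.
have x0 : p ^+ s.+2 / y != 0 by rewrite mulf_neq0 ?invr_neq0 ?expf_neq0.
have := has_sumZ (c := p ^+ 'C(s.+1, 2) * qpoch w p s * qpoch_inf (w * p ^+ s.+1) P * iq s *
   (qpoch_inf (- y) p * qpoch_inf (- p) p / qpoch_inf p p)) (jacobi_sum Kc p1 p0 x0).
by apply: eq_has_sum => n /=; rewrite mulrC.
Qed.

Let c0 : K := qpoch_inf (- y) p * qpoch_inf (- p) p / qpoch_inf p p.

Lemma sqr_expr k : P ^+ k = p ^+ k.*2.
Proof. by rewrite -exprM mul2n. Qed.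

Lemma even_power m :
  p ^+ 'C(m.*2.+1, 2) * (p * y) ^+ m.+1 / P ^+ 'C(m.+2, 2) =
  y / p * (P ^+ 'C(m, 2) * y ^+ m).
Proof.
have P2 : P ^+ 'C(m.+2, 2) != 0 by rewrite expf_neq0.
apply: (mulIf P2); rewrite divfK // exprMn.
have e : p ^+ 'C(m.*2.+1, 2) * p ^+ m.+1 * p = P ^+ 'C(m, 2) * P ^+ 'C(m.+2, 2).
  rewrite -!exprD -exprSr sqr_expr; congr (p ^+ _).
  by have := sqrn_bin2 m; have := sqrn_bin2 m.*2; rewrite !bin2S; lia.
apply: (mulIf p0).
transitivity (p ^+ 'C(m.*2.+1, 2) * p ^+ m.+1 * p * y ^+ m.+1); first by ring.
by rewrite e (exprS y); field.
Qed.

Lemma odd_power m :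
  p ^+ 'C(m.*2.+2, 2) * y ^+ m.+1 / P ^+ 'C(m.+2, 2) =
  y / p * (P ^+ 'C(m, 2) * (p * y) ^+ m).
Proof.
have P2 : P ^+ 'C(m.+2, 2) != 0 by rewrite expf_neq0.
apply: (mulIf P2); rewrite divfK // [(p * y) ^+ m]exprMn.
have e : p ^+ 'C(m.*2.+2, 2) * p = P ^+ 'C(m, 2) * p ^+ m * P ^+ 'C(m.+2, 2).
  rewrite mulrAC -!exprD -exprSr sqr_expr -exprD; congr (p ^+ _).
  by have := sqrn_bin2 m; have := sqrn_bin2 m.*2; rewrite !bin2S; lia.
apply: (mulIf p0).
transitivity (p ^+ 'C(m.*2.+2, 2) * p * y ^+ m.+1); first by ring.
by rewrite e (exprS y); field.
Qed.

Lemma exprN_sign (z : K) m : (-1) ^+ m * (- z) ^+ m = z ^+ m.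
Proof. by rewrite -exprMn mulN1r opprK. Qed.

(** By quasi-periodicity the theta value at s = 2m is a power times a theta
    function that does not depend on m; in base p^2 what is left is the term of a
    1phi1 series. *)
Lemma sum_dutn_even m : sum_dutn m.*2 =
  c0 * qpoch_inf P P * qpoch_inf (- (p * y)) P * qpoch_inf w P *
  qpoch_inf (w * p) P * (y / p) * phi11 P (- y) p m.
Proof.
rewrite /sum_dutn -/c0 /theta_value.
have pm : p ^+ m.*2 != 0 by rewrite expf_neq0.
have -> : - (p * (p ^+ m.*2.+2 / y)) = - (P ^+ m.+2 / (p * y)).
  by rewrite sqr_expr !doubleS !exprS; field; rewrite ?y0 ?p0.
have -> : - (p / (p ^+ m.*2.+2 / y)) = - (p * y / P ^+ m.+1).
  by rewrite sqr_expr !doubleS !exprS; field; rewrite ?pm ?y0 ?p0.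
have py0 : p * y != 0 by rewrite mulf_neq0.
rewrite [qpoch_inf (- (_ / (p * y))) P * _]mulrC.
rewrite (theta_shift Kc P1 P0 _ py0).
have -> : - (P / (p * y)) = w by field; rewrite y0 p0.
rewrite (qpoch_double w).
have -> : w * p ^+ m.*2.+1 = w * p * P ^+ m by rewrite sqr_expr exprS mulrA.
rewrite (qpoch_infD Kc (w * p) m P1).
have -> : iq m.*2 = (qpoch p P m)^-1 * (qpoch P P m)^-1.
  by rewrite /qfac_inv qpoch_double -expr2 invfM.
rewrite /phi11 prod_linear ?oppr_eq0 // invfM invrN mulrN.
transitivity (p ^+ 'C(m.*2.+1, 2) * (p * y) ^+ m.+1 / P ^+ 'C(m.+2, 2) *
  (qpoch w P m * qpoch (w * p) P m * qpoch_inf (w * p * P ^+ m) P *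
  ((qpoch p P m)^-1 / qpoch P P m) * c0 * qpoch_inf P P * qpoch_inf (- (p * y)) P * qpoch_inf w P));
  first by ring.
rewrite even_power -(exprN_sign y m); ring.
Qed.

Lemma qpoch_doubleS a m :
  qpoch a p m.*2.+1 = qpoch a P m.+1 * qpoch (a * p) P m.
Proof. by rewrite qpochSr qpoch_double (qpochSr a P) sqr_expr; ring. Qed.

(** As for even s; the two parities lead to two different theta functions and
    two different 1phi1 series. *)
Lemma sum_dutn_odd m : sum_dutn m.*2.+1 =
  c0 * qpoch_inf P P * qpoch_inf (- y) P * qpoch_inf w P *
  qpoch_inf (w * p) P * (y / p) / (1 - p) * phi11 P (- (p * y)) (p * P) m.
Proof.
rewrite /sum_dutn -/c0 /theta_value.
have pm : p ^+ m.*2 != 0 by rewrite expf_neq0.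
have py0 : p * y != 0 by rewrite mulf_neq0.
have -> : - (p * (p ^+ m.*2.+3 / y)) = - (P ^+ m.+2 / y).
  by rewrite sqr_expr !doubleS !exprS; field; rewrite ?y0 ?p0.
have -> : - (p / (p ^+ m.*2.+3 / y)) = - (y / P ^+ m.+1).
  by rewrite sqr_expr !doubleS !exprS; field; rewrite ?pm ?y0 ?p0.
rewrite [qpoch_inf (- (_ / y)) P * _]mulrC.
rewrite (theta_shift Kc P1 P0 _ y0).
have -> : - (P / y) = w * p by field; rewrite y0.
rewrite (qpoch_doubleS w).
have -> : w * p ^+ m.*2.+2 = w * P ^+ m.+1 by rewrite sqr_expr.
rewrite (qpoch_infD Kc w m.+1 P1).
have -> : iq m.*2.+1 = (1 - p)^-1 * (qpoch (p * P) P m)^-1 * (qpoch P P m)^-1.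
  by rewrite /qfac_inv qpoch_doubleS qpochSl -expr2 !invfM.
rewrite /phi11 prod_linear ?oppr_eq0 // invfM.
have -> : p * P / - (p * y) = w * p by field; rewrite ?oppr_eq0 ?y0 ?p0.
transitivity (p ^+ 'C(m.*2.+2, 2) * y ^+ m.+1 / P ^+ 'C(m.+2, 2) *
  (qpoch w P m.+1 * qpoch (w * p) P m * qpoch_inf (w * P ^+ m.+1) P *
  ((1 - p)^-1 / qpoch (p * P) P m / qpoch P P m) * c0 * qpoch_inf P P *
    (qpoch_inf (- y) P * qpoch_inf (w * p) P)));
  first by ring.
rewrite odd_power -(exprN_sign (p * y) m); ring.
Qed.

(** The factors that the even and the odd series lack in their prefactors are
    exactly those that phi11_sum supplies, so both contribute the same amount:
    hence the factor 2.  The product is simplified by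
    (p;p^2)_oo (-p;p)_oo = 1, due to Euler. *)
Lemma sum_dutn_sum_s S : has_sum sum_dutn S ->
  S = 2 * (y / p) * (qpoch_inf (- p) p ^+ 3 * qpoch_inf (- y) p ^+ 2 * qpoch_inf w p).
Proof.
move=> hS.
have p31 : `|p * P| < 1 by rewrite normrM mulr_ilt1.
have he := has_sumZ (c := c0 * qpoch_inf P P * qpoch_inf (- (p * y)) P * qpoch_inf w P *
  qpoch_inf (w * p) P * (y / p)) (phi11_sum Kc P1 (- y) p1).
have ho := has_sumZ (c := c0 * qpoch_inf P P * qpoch_inf (- y) P * qpoch_inf w P *
  qpoch_inf (w * p) P * (y / p) / (1 - p)) (phi11_sum Kc P1 (- (p * y)) p31).
rewrite (has_sum_parity hS (eq_has_sum (fun m => esym (sum_dutn_even m)) he)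
  (eq_has_sum (fun m => esym (sum_dutn_odd m)) ho)).
have hw := qpoch_inf_double Kc w p1.
have hy := qpoch_inf_double Kc (- y) p1.
have hp := qpoch_inf_double Kc p p1.
have ho2 := qpoch_inf_mulN Kc p p1.
have h1 := qpoch_infD Kc p 1 P1.
rewrite /qpoch big_ord1 expr0 mulr1 expr1 in h1.
have yp : - y * p = - (p * y) by ring.
rewrite yp in hy.
have n1 : qpoch_inf p p != 0 by exact: qpoch_inf_neq0.
have n2 : qpoch_inf p P != 0 by exact: qpoch_inf_neq0.
have n3 : qpoch_inf (p * P) P != 0 by exact: qpoch_inf_neq0.
have n4 : 1 - p != 0 by move: n2; rewrite h1 mulf_eq0 negb_or => /andP[].
have e1 : qpoch_inf p P * qpoch_inf (- p) p = 1.
  apply: (mulfI n1); rewrite mulr1 mulrCA ho2.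
  by rewrite hp expr2.
have e2 : (qpoch_inf p P)^-1 = qpoch_inf (- p) p.
  by rewrite -[LHS]mulr1 -e1 mulKf.
have e3 : qpoch_inf P P / qpoch_inf p p = qpoch_inf (- p) p.
  by rewrite -ho2 mulrAC divff ?mul1r.
transitivity (2 * (y / p) * qpoch_inf (- y) p * qpoch_inf (- p) p *
  (qpoch_inf (- y) P * qpoch_inf (- (p * y)) P) * (qpoch_inf w P * qpoch_inf (w * p) P) *
  (qpoch_inf P P / qpoch_inf p p) * (qpoch_inf p P)^-1).
  by rewrite /c0 h1; field; rewrite n1 n3 n4 p0.
by rewrite -hw -hy e3 e2; ring.
Qed.

End TadpoleSum.

(** The sum S of the lifted family exists by boundedness.  Evaluating it along one
    order of summation gives the product, and along the other the sum of tadpole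
    terms. *)
Lemma tadpole_sum (K : numFieldType) (p y rho : K) : abs_complete K ->
  p != 0 -> `|p| < 1 -> y != 0 -> 0 <= rho -> rho ^+ 2 = `|p| ->
  has_sum (tadpole_term p y) (2 * (y / p) *
   (qpoch_inf (- p) p ^+ 3 * qpoch_inf (- y) p ^+ 2 * qpoch_inf (- (p / y)) p)).
Proof.
move=> Kc p0 p1 y0 r0 rE.
have [S hS] := Kc _ _ (abs_bounded_lifted Kc p0 p1 y0 r0 rE).
have h1 := has_sum_fiber hS (lifted_sum_d Kc p0 p1 y0).
have h2 : has_sum (sum_du p y) S by apply: sum_d_sum_u h1.
have h3 : has_sum (sum_dut p y) S by apply: sum_du_sum_t h2.
have : has_sum (sum_dutn p y) S by apply: sum_dut_sum_n h3.
by move=> /sum_dutn_sum_s <- //; exact: lifted_sum_s hS.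
Qed.

(** * Completeness of the complex numbers *)

Section Completeness.
Variable R : realType.

(** The sum is the supremum of the finite partial sums. *)
Lemma nonneg_has_sum (I : choiceType) (f : I -> R) : (forall i, 0 <= f i) ->
  abs_bounded f -> exists s, has_sum f s.
Proof.
move=> f0 [M hM].
pose E := [set x | exists A : {fset I}, x = \sum_(i <- A) f i].
have hE : has_sup E.
  split; first by exists 0, fset0; rewrite big_seq_fset0.
  exists M => _ [A ->]; apply: le_trans (hM A).
  by rewrite ler_sum // => i _; exact: ler_norm.
exists (sup E); apply/has_sumP => e e0.
have [_ [A0 ->] h] := sup_adherent e0 hE.
exists A0 => A A0A.
have hA : \sum_(i <- A) f i <= sup E by apply: sup_upper_bound => //; exists A.
rewrite ger0_norm ?subr_ge0 // ltrBlDr -ltrBlDl.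
by apply: lt_le_trans h _; exact: ler_sum_fset.
Qed.

(** f is the difference of the nonnegative families |f| + f and |f|. *)
Lemma real_abs_complete : abs_complete R.
Proof.
move=> I f [M hM].
have [s hs] : exists s, has_sum (fun i => `|f i|) s.
  by apply: nonneg_has_sum => //; exists M => A; under eq_bigr do rewrite normr_id.
have [t ht] : exists s, has_sum (fun i => `|f i| + f i) s.
  apply: nonneg_has_sum => [i|].
    by rewrite addrC -lerBlDr sub0r lerNnormlW.
  apply: (@abs_bounded_dom _ _ _ f 2) => //; last by exists M.
  by move=> i; apply: le_trans (ler_normD _ _) _; rewrite normr_id mulr_natl.
exists (t - s); apply: eq_has_sum (has_sumB ht hs) => i.
by rewrite addrAC subrr add0r.
Qed.

Local Notation C := (R[i]).
Local Open Scope complex_scope.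

Lemma norm_complex_le (z : C) : `|z| <= (`|complex.Re z| + `|complex.Im z|)%:C.
Proof.
rewrite normc_def lecR -[leRHS](ger0_norm (addr_ge0 _ _)) // -sqrtr_sqr.
apply: ler_wsqrtr; rewrite sqrrD !real_normK ?num_real // lerD2r lerDl.
by rewrite mulrn_wge0 ?mulr_ge0.
Qed.

Lemma Re_le_norm (z : C) : (`|complex.Re z|)%:C <= `|z|.
Proof. by rewrite normc_def lecR -sqrtr_sqr ler_wsqrtr // lerDl sqr_ge0. Qed.

Lemma Im_le_norm (z : C) : (`|complex.Im z|)%:C <= `|z|.
Proof. by rewrite normc_def lecR -sqrtr_sqr ler_wsqrtr // lerDr sqr_ge0. Qed.

(** Real and imaginary parts are summed separately. *)
Lemma complex_abs_complete : abs_complete C.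
Proof.
move=> I f [M hM].
have bnd (g : I -> R) : (forall i, (`|g i|)%:C <= `|f i|) -> abs_bounded g.
  move=> gf; exists (complex.Re M) => A.
  have : (\sum_(i <- A) `|g i|)%:C <= M.
    by apply: le_trans (hM A); rewrite rmorph_sum /=; apply: ler_sum => i _; exact: gf.
  by rewrite lecE => /andP[].
have [a ha] := real_abs_complete (bnd _ (fun i => Re_le_norm (f i))).
have [b hb] := real_abs_complete (bnd _ (fun i => Im_le_norm (f i))).
exists (a +i* b); apply/has_sumP => e.
case: e => e1 e2; rewrite ltcE /= => /andP[/eqP e20 e10].
have e2' : 0 < e1 / 2 by rewrite divr_gt0.
have /has_sumP /(_ _ e2') [A1 h1] := ha.
have /has_sumP /(_ _ e2') [A2 h2] := hb.
exists (A1 `|` A2)%fset => A; rewrite fsubUset => /andP[/h1 {}h1 /h2 {}h2].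
apply: le_lt_trans (norm_complex_le _) _.
rewrite ltcE /= e20 eqxx /=.
have sumRe : complex.Re (\sum_(i <- A) f i) = \sum_(i <- A) complex.Re (f i).
  by apply: (big_morph (@complex.Re R)) => // -[x1 y1] [x2 y2].
have sumIm : complex.Im (\sum_(i <- A) f i) = \sum_(i <- A) complex.Im (f i).
  by apply: (big_morph (@complex.Im R)) => // -[x1 y1] [x2 y2].
move: h1 h2; rewrite -sumRe -sumIm; case: (\sum_(i <- A) f i) => x z /= h1 h2.
by rewrite [e1]splitr ltrD.
Qed.

End Completeness.


Section EtaQuotients.
Variable K : numFieldType.
Hypothesis Kc : abs_complete K.
Variables q rho : K.
Hypothesis q0 : q != 0.
Hypothesis q1 : `|q| < 1.
Hypothesis rho_ge0 : 0 <= rho.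
Hypothesis rhoE : rho ^+ 2 = `|q|.

(** (q)_oo (-q)_oo = (q^2; q^2)_oo. *)
Lemma J_quotient k : J q 2 ^+ k / J q 1 ^+ k = qpoch_inf (- q) q ^+ k.
Proof.
have J1n : qpoch_inf q q != 0 by exact: qpoch_inf_neq0.
rewrite -expr_div_n /J expr1 -(qpoch_inf_mulN Kc q q1).
by rewrite mulrAC divff ?mul1r.
Qed.

Lemma qpoch_inf_N1 : qpoch_inf (- 1) q = 2 * qpoch_inf (- q) q.
Proof.
by rewrite (qpoch_infD Kc _ 1 q1) /qpoch big_ord1 expr0 expr1 mulr1 opprK mulN1r.
Qed.

(** At y = 1 each of the two factors (-y)_oo = 2 (-q)_oo contributes a 2. *)
Lemma tadpole_sum_1 :
  has_sum (tadpole_term q 1) (8 * q^-1 * (J q 2 ^+ 6 / J q 1 ^+ 6)).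
Proof.
have := tadpole_sum Kc q0 q1 (oner_neq0 K) rho_ge0 rhoE.
rewrite J_quotient qpoch_inf_N1 divr1.
by congr (has_sum _ _); ring.
Qed.

(** In base q^2 the products of -q and of -q^2 interleave to (-q;q)_oo. *)
Lemma tadpole_sum_sqr :
  has_sum (tadpole_term (q ^+ 2) q) (2 * q^-1 * (J q 2 ^+ 3 / J q 1 ^+ 3)).
Proof.
have q20 : q ^+ 2 != 0 by rewrite expf_neq0.
have q21 : `|q ^+ 2| < 1 by rewrite normrX exprn_ilt1.
have rhoE2 : `|q| ^+ 2 = `|q ^+ 2| by rewrite normrX.
have := tadpole_sum Kc q20 q21 q0 (normr_ge0 q) rhoE2.
rewrite J_quotient (qpoch_inf_double Kc _ q1) mulNr -expr2.
have -> : q / q ^+ 2 = q^-1 by field.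
have -> : q ^+ 2 / q = q by field.
by congr (has_sum _ _); ring.
Qed.

(** At y = q the last factor is (-1)_oo = 2 (-q)_oo. *)
Lemma tadpole_sum_diag :
  has_sum (tadpole_term q q) (4 * (J q 2 ^+ 6 / J q 1 ^+ 6)).
Proof.
have := tadpole_sum Kc q0 q1 q0 rho_ge0 rhoE.
rewrite J_quotient divff // qpoch_inf_N1.
by congr (has_sum _ _); ring.
Qed.

End EtaQuotients.

Lemma qfac_inv_prod (K : numFieldType) (p : K) (i j k l : nat) :
  qfac_inv p i * qfac_inv p j * qfac_inv p k * qfac_inv p l =
  (qpoch p p i * qpoch p p j * qpoch p p k * qpoch p p l)^-1.
Proof. by rewrite !invfM. Qed.

Theorem theorem1p1 (R : realType) (q : R[i])
    (q_neq0 : 0 < `|q|) (q_lt1 : `|q| < 1) :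
  [/\ has_sum
        (fun '((i, j, k, l) : nat * nat * nat * nat) =>
           q ^ (((i%:Z ^+ 2 - i%:Z) %/ 2)%Z
                + j%:Z ^+ 2 + k%:Z ^+ 2 + l%:Z ^+ 2
                - i%:Z * l%:Z - j%:Z * k%:Z - j%:Z * l%:Z
                - 2 * j%:Z + 2 * k%:Z + l%:Z)
           / (qpoch q q i * qpoch q q j * qpoch q q k * qpoch q q l))
        (8 * q^-1 * (J q 2 ^+ 6 / J q 1 ^+ 6)),
      has_sum
        (fun '((i, j, k, l) : nat * nat * nat * nat) =>
           q ^ (i%:Z ^+ 2 + 2 * j%:Z ^+ 2 + 2 * k%:Z ^+ 2 + 2 * l%:Z ^+ 2
                - 2 * i%:Z * l%:Z - 2 * j%:Z * k%:Z - 2 * j%:Z * l%:Z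
                - 3 * j%:Z + 3 * k%:Z + l%:Z)
           / (qpoch (q ^+ 2) (q ^+ 2) i * qpoch (q ^+ 2) (q ^+ 2) j
              * qpoch (q ^+ 2) (q ^+ 2) k * qpoch (q ^+ 2) (q ^+ 2) l))
        (2 * q^-1 * (J q 2 ^+ 3 / J q 1 ^+ 3))
    & has_sum
        (fun '((i, j, k, l) : nat * nat * nat * nat) =>
           q ^ (((i%:Z ^+ 2 + i%:Z) %/ 2)%Z
                + j%:Z ^+ 2 + k%:Z ^+ 2 + l%:Z ^+ 2
                - i%:Z * l%:Z - j%:Z * k%:Z - j%:Z * l%:Z
                - j%:Z + k%:Z)
           / (qpoch q q i * qpoch q q j * qpoch q q k * qpoch q q l))
        (4 * (J q 2 ^+ 6 / J q 1 ^+ 6))].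
Proof.
have Kc := @complex_abs_complete R.
have q0 : q != 0 by rewrite -normr_gt0.
have rho0 : 0 <= sqrtC `|q| by rewrite sqrtC_ge0.
have rhoE : sqrtC `|q| ^+ 2 = `|q| by rewrite sqrtCK.
split.
- apply: eq_has_sum (tadpole_sum_1 Kc q0 q_lt1 rho0 rhoE) => -[[[i j] k] l].
  rewrite /tadpole_term qfac_inv_prod exp1rz mulr1; congr (q ^ _ / _).
  have -> : ((i%:Z ^+ 2 - i%:Z) %/ 2)%Z = tri i by rewrite expr2 -triE mulrC mulzK.
  by rewrite /tadpole_exp; ring.
- apply: eq_has_sum (tadpole_sum_sqr Kc q0 q_lt1) => -[[[i j] k] l].
  rewrite /tadpole_term qfac_inv_prod (exprnP q 2) exprz_exp -expfzDr //.
  congr (q ^ _ / _).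
  by rewrite /tadpole_exp !mulrDr triE; ring.
- apply: eq_has_sum (tadpole_sum_diag Kc q0 q_lt1 rho0 rhoE) => -[[[i j] k] l].
  rewrite /tadpole_term qfac_inv_prod -expfzDr //; congr (q ^ _ / _).
  have -> : ((i%:Z ^+ 2 + i%:Z) %/ 2)%Z = tri i.+1 by rewrite expr2 -triSE mulrC mulzK.
  by rewrite /tadpole_exp; apply: int_double_inj; rewrite !mulrDr triE triSE; ring.
Qed.
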